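(* Let $n\ge d\ge 1$ be integers and let $m=n+d+1$. Suppose that $A(t)\in\mathbb{R}^{d\times m}$ evolves by $-1$ times mean curvature on the orbit $\mathcal{O}_{A(t)}$, that is, $$\dot A(t)=-\mathbf{h}(A(t)),\qquad t\ge 0,$$ and that $A(0)$ has distinct positive singular values $r_1(0)>\dots>r_d(0)>0$. Let $$A(0)=P\,\mathrm{diag}\big(r_1(0),\dots,r_d(0)\big)\,I_{d\times m}\,Q^T$$ be the singular value decomposition of $A(0)$, with $P\in\mathrm{O}(d)$, $Q\in\mathrm{O}(m)$. Then $$A(t)=P\,\mathrm{diag}\big(r_1(t),\dots,r_d(t)\big)\,I_{d\times m}\,Q^T,$$ where the singular values $r_1(t)>\dots>r_d(t)>0$ of $A(t)$ satisfy the ODE system $$\dot r_k(t)=\sum_{j\colon j\ne k}\left(\frac{1}{r_k(t)-r_j(t)}+\frac{1}{r_k(t)+r_j(t)}\right)+\frac{n+1}{r_k(t)},\qquad k=1,\dots,d.$$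
   Context: $\mathbb{R}^{d\times m}$ is the space of real $d\times m$ matrices with the Frobenius inner product $\langle A,B\rangle=\mathrm{Tr}(AB^T)$; $I_{d\times m}$ is the $d\times m$ matrix with ones on the main diagonal and zeros elsewhere. The group $\mathrm{O}(d)\times\mathrm{O}(m)$ acts isometrically by $(U,V)\cdot A=UAV^T$, and $\mathcal{O}_A=\{UAV^T : U\in\mathrm{O}(d),\,V\in\mathrm{O}(m)\}$ is the orbit of $A$, a compact embedded submanifold of the Euclidean space $\mathbb{R}^{d\times m}$. The mean curvature vector of $\mathcal{O}_A$ at $A$ is the (unnormalized) trace of the second fundamental form, $\mathbf{h}(A)=\sum_\alpha II(e_\alpha,e_\alpha)\in T_A^\perp\mathcal{O}_A$, where $\{e_\alpha\}$ is any orthonormal basis of $T_A\mathcal{O}_A$ and $II(X,Y)=(D_XY)^\perp$ is the component normal to $\mathcal{O}_A$ of the ambient flat derivative. A dot denotes the derivative in $t$; sums over $j$ range over $\{1,\dots,d\}\setminus\{k\}$. *)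

(* Defs.v *)
From HB Require Import structures.
From mathcomp Require Import all_boot all_order all_algebra.
From mathcomp Require Import all_classical all_reals all_analysis.

Set Implicit Arguments.
Unset Strict Implicit.
Unset Printing Implicit Defensive.

Import Order.TTheory GRing.Theory Num.Theory.
Import numFieldNormedType.Exports.

Local Open Scope classical_set_scope.
Local Open Scope ring_scope.

(* [f] has derivative [l] at [t] relative to the domain [D].  For [D] the half
   line [0 <= s] this is the usual derivative if [0 < t], and the right
   derivative if [t = 0]. *)
Definition has_derivative_within (R : realType) (V : normedModType R)
    (D : set R) (f : R -> V) (t : R) (l : V) : Prop :=
  (s - t)^-1 *: (f s - f t) @[s --> within D t^'] --> l.

Section Submanifold.
Variables (R : realType) (d m : nat).
Implicit Types (S W : set 'M[R]_(d, m)) (A B X Y Z N : 'M[R]_(d, m)).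

Definition frobenius A B : R := \tr (A *m B^T).

(* For an embedded submanifold [S], differentiability of the curve at 0 gives
   the same velocities as smoothness. *)
Definition tangent_space S A : set 'M[R]_(d, m) :=
  [set X | exists g : R -> 'M[R]_(d, m),
     [/\ forall s, S (g s), g 0 = A & is_derive (0 : R) (1 : R) g X]].

Definition normal_component W X N : Prop :=
  (forall Z, W Z -> frobenius N Z = 0) /\ W (X - N).

(* The normal component of [D_X F] at [A], where [F] is any vector field
   tangent to [S] that extends [Y].  For [X] and [Y] tangent at [A] to an
   embedded submanifold it does not depend on [F], so [xget] chooses from a
   singleton. *)
Definition second_fundamental_form S A X Y : 'M[R]_(d, m) :=
  xget 0 [set N | exists F : 'M[R]_(d, m) -> 'M[R]_(d, m),
    [/\ differentiable F A,
        \forall B \near A, S B -> tangent_space S B (F B),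
        F A = Y &
        normal_component (tangent_space S A) ('D_X F A) N]].

Definition orthonormal_basis W (k : nat) (e : 'I_k -> 'M[R]_(d, m)) : Prop :=
  [/\ forall i, W (e i),
      forall i j, frobenius (e i) (e j) = (i == j)%:R &
      forall X, W X -> exists c : 'I_k -> R, X = \sum_i c i *: e i].

(* The unnormalized trace of the second fundamental form; it does not depend on
   the orthonormal basis, so again [xget] chooses from a singleton. *)
Definition mean_curvature S A : 'M[R]_(d, m) :=
  xget 0 [set h | exists (k : nat) (e : 'I_k -> 'M[R]_(d, m)),
    orthonormal_basis (tangent_space S A) e /\
    h = \sum_i second_fundamental_form S A (e i) (e i)].

End Submanifold.

Definition orthogonal_group (R : realType) (n : nat) : set 'M[R]_n :=
  [set U | U *m U^T = 1%:M].

Definition orbit_mx (R : realType) (d m : nat) (A : 'M[R]_(d, m)) :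
    set 'M[R]_(d, m) :=
  [set B | exists U V, [/\ orthogonal_group U, orthogonal_group V &
                           B = U *m A *m V^T]].

(* [A = P diag(r) I Q^T] with [P], [Q] orthogonal and [r] nonnegative and
   nonincreasing, so that [r] lists the singular values of [A] with
   multiplicity when [d <= m].  [pid_mx d] is the [d x m] matrix with ones on
   the main diagonal. *)
Definition is_svd (R : realType) (d m : nat) (A : 'M[R]_(d, m))
    (P : 'M[R]_d) (r : 'rV[R]_d) (Q : 'M[R]_m) : Prop :=
  [/\ orthogonal_group P, orthogonal_group Q,
      (forall i, 0 <= r 0 i),
      (forall i j : 'I_d, (i <= j)%N -> r 0 j <= r 0 i) &
      A = P *m diag_mx r *m pid_mx d *m Q^T].

Definition distinct_positive (R : realType) (d : nat) (r : 'rV[R]_d) : Prop :=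
  (forall i, 0 < r 0 i) /\ (forall i j : 'I_d, (i < j)%N -> r 0 j < r 0 i).

(* Main.v *)
Require Import Defs.
From HB Require Import structures.
From mathcomp Require Import all_boot all_order all_algebra.
From mathcomp Require Import all_classical all_reals all_analysis.
From mathcomp Require Import ring lra.
Import Order.TTheory GRing.Theory Num.Theory.
Import numFieldNormedType.Exports.
Local Open Scope classical_set_scope.
Local Open Scope ring_scope.

Set Implicit Arguments.
Unset Strict Implicit.
Unset Printing Implicit Defensive.

(** Write [D_r] for the rectangular diagonal matrix with entries [r_i] and
    [p = m - d] for the number of extra columns.

    The vectors [u A + A v^T] with [u], [v] skew are velocities of curves in the
    orbit of [A] ([infact_tangent]).  When [A = P D_r Q^T] with distinct positive
    [r_i], they are all the tangent vectors: in the frame of [P] and [Q] the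
    tangent space consists of the matrices with zero diagonal
    ([tangent_spaceP]).  Indeed a curve [g] in the orbit satisfies a fixed
    polynomial equation in [g g^T], which freezes the diagonal to first order
    ([tangent_rdiagonal]), and conversely [X = u D_r + D_r v^T] can be solved
    pair of indices by pair of indices ([infact_solveK]).  A normal vector [Z]
    can be carried along the orbit by the same orthogonal matrices, whence
    [<II(X, X), Z> = - <X, u Z + Z v^T>] for [X = u A + A v^T]
    ([second_fundamental_form_pairing]).  The trace of this quadratic form gives
    [- h(A) = P D_g Q^T], where [g] is the gradient of the logarithm of
    [prod_(i < j) (r_i^2 - r_j^2) prod_i r_i^p], the volume of the orbit up to a
    constant ([mean_curvature_svd]).

    It remains to see that the flow line stays of the form [P D_r Q^T], with
    distinct positive [r_i].  Put [B = P^T A Q] and let [N] be its velocity.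

    The matrix [B] stays diagonal because [N] is normal to the orbit at every
    point ([mean_curvature_normal]), so that [N B^T] and [B^T N] are symmetric
    ([normal_symmetric]).  For [B] near a diagonal matrix with distinct positive
    entries these linear relations bound the off-diagonal entries of [N], up to a
    constant, by those of [B] times the size of [N] ([symmetric_pair_entry]).
    The size of [N] is bounded there: the point of the orbit of [B] nearest to
    [D_r] is itself diagonal, hence gives singular values of [B] close to [r]
    ([nearest_rdiag], [mean_curvature_bounded]).  The squared norm of the
    off-diagonal part then satisfies [E' <= C E] and stays zero
    ([diagonal_persists]).

    The singular values do not collide, nor reach zero, because the flow is the
    gradient flow of the logarithm of the volume: the volume does not decrease
    ([derive_sqr_volume]), so its limit at the end of an interval is positive
    ([good_closed]).  The set of times up to which the flow line has the required
    form is therefore both closed and open to the right ([flow_good]). *)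

(** * Calculus of matrix-valued functions *)

Section MatrixLimits.
Variables (R : realType) (T : Type) (F : set_system T).
Context {FF : Filter F}.

Lemma cvg_mxP p q (f : T -> 'M[R]_(p, q)) (L : 'M[R]_(p, q)) :
  f @ F --> L <-> forall i j, (fun t => f t i j) @ F --> L i j.
Proof.
split=> [fL i j|fL].
  exact: (cvg_comp _ _ fL (@coord_continuous R p q i j L)).
apply/cvgrPdist_le => e e0; near=> t.
rewrite /Num.Def.normr/= mx_normrE (bigmax_le _ (ltW e0))//= => -[i j] _ /=.
rewrite !mxE/=.
suff /(_ (i, j)) : forall k : 'I_p * 'I_q, `|L k.1 k.2 - f t k.1 k.2| <= e by [].
near: t; apply: filter_forall => -[a b] /=.
exact: ((cvgrPdist_le _ _).1 (fL a b)).
Unshelve. all: by end_near. Qed.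

Lemma cvg_sumr (I : Type) (s : seq I) (P : pred I) (f : I -> T -> R) (l : I -> R) :
  (forall i, f i @ F --> l i) ->
  (fun t => \sum_(i <- s | P i) f i t) @ F --> \sum_(i <- s | P i) l i.
Proof.
move=> fl; elim: s => [|a s IH].
  rewrite big_nil; under eq_fun do rewrite big_nil; exact: cvg_cst.
rewrite big_cons; under eq_fun do rewrite big_cons.
by case: (P a) => //; apply: cvgD.
Qed.

Lemma cvg_prodr (I : Type) (s : seq I) (P : pred I) (f : I -> T -> R) (l : I -> R) :
  (forall i, f i @ F --> l i) ->
  (fun t => \prod_(i <- s | P i) f i t) @ F --> \prod_(i <- s | P i) l i.
Proof.
move=> fl; elim: s => [|a s IH].
  rewrite big_nil; under eq_fun do rewrite big_nil; exact: cvg_cst.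
rewrite big_cons; under eq_fun do rewrite big_cons.
by case: (P a) => //; apply: cvgM.
Qed.

Lemma cvg_mulmx p q k (f : T -> 'M[R]_(p, q)) (g : T -> 'M[R]_(q, k))
    (L : 'M[R]_(p, q)) (M : 'M[R]_(q, k)) :
  f @ F --> L -> g @ F --> M -> (fun t => f t *m g t) @ F --> L *m M.
Proof.
move=> /cvg_mxP fL /cvg_mxP gM; apply/cvg_mxP => i j.
rewrite mxE; under eq_fun do rewrite mxE.
by apply: cvg_sumr => l; apply: cvgM.
Qed.

Lemma cvg_trmx p q (f : T -> 'M[R]_(p, q)) (L : 'M[R]_(p, q)) :
  f @ F --> L -> (fun t => (f t)^T) @ F --> L^T.
Proof.
move=> /cvg_mxP fL; apply/cvg_mxP => i j.
by rewrite mxE; under eq_fun do rewrite mxE; exact: fL.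
Qed.

Lemma cvg_frobenius p q (f g : T -> 'M[R]_(p, q)) (L M : 'M[R]_(p, q)) :
  f @ F --> L -> g @ F --> M ->
  (fun t => frobenius (f t) (g t)) @ F --> frobenius L M.
Proof.
move=> fL gM; apply: cvg_sumr => i.
by have /cvg_mxP := cvg_mulmx fL (cvg_trmx gM).
Qed.

End MatrixLimits.

Section MatrixDerivatives.
Variables (R : realType) (V : normedModType R).
Implicit Types x v : V.

Lemma is_derive_mxP p q (f : V -> 'M[R]_(p, q)) x v L :
  is_derive x v f L <-> forall i j, is_derive x v (fun t => f t i j : R) (L i j).
Proof.
split=> [[df fL] i j|dfL].
  have dfij := (derivable_mxP f x v).1 df i j.
  by apply: DeriveDef => //; rewrite -fL (derive_mx df) mxE.
have df : derivable f x v by apply/derivable_mxP => i j; case: (dfL i j).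
apply: DeriveDef => //; rewrite (derive_mx df); apply/matrixP => i j.
by rewrite mxE; case: (dfL i j).
Qed.

Lemma is_derive_sumr (I : Type) (s : seq I) (P : pred I) (f : I -> V -> R)
    (l : I -> R) x v :
  (forall i, P i -> is_derive x v (f i) (l i)) ->
  is_derive x v (fun t => \sum_(i <- s | P i) f i t) (\sum_(i <- s | P i) l i).
Proof.
move=> fl; elim: s => [|a s IH].
  rewrite big_nil; under eq_fun do rewrite big_nil; exact: is_derive_cst.
rewrite big_cons; under eq_fun do rewrite big_cons.
by case: ifP => // /fl Pa; apply: is_deriveD.
Qed.

Lemma is_derive_mulr (f g : V -> R) x v (df dg : R) :
  is_derive x v f df -> is_derive x v g dg ->
  is_derive x v (fun t => f t * g t) (df * g x + f x * dg).
Proof.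
move=> fx gx; apply: is_derive_eq (is_deriveM fx gx) _.
by rewrite /GRing.scale/= addrC [X in X + _]mulrC.
Qed.

Lemma is_derive_mulmx p q k (f : V -> 'M[R]_(p, q)) (g : V -> 'M[R]_(q, k))
    x v df dg :
  is_derive x v f df -> is_derive x v g dg ->
  is_derive x v (fun t => f t *m g t) (df *m g x + f x *m dg).
Proof.
move=> /is_derive_mxP fx /is_derive_mxP gx; apply/is_derive_mxP => i j.
rewrite !mxE -big_split/=; under eq_fun do rewrite mxE.
by apply: is_derive_sumr => l _; exact: is_derive_mulr.
Qed.

Lemma is_derive_trmx p q (f : V -> 'M[R]_(p, q)) x v df :
  is_derive x v f df -> is_derive x v (fun t => (f t)^T) df^T.
Proof.
move=> /is_derive_mxP fx; apply/is_derive_mxP => i j.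
by rewrite !mxE; under eq_fun do rewrite mxE; exact: fx.
Qed.

Lemma is_derive_frobenius p q (f g : V -> 'M[R]_(p, q)) x v df dg :
  is_derive x v f df -> is_derive x v g dg ->
  is_derive x v (fun t => frobenius (f t) (g t))
    (frobenius df (g x) + frobenius (f x) dg).
Proof.
move=> fx gx; rewrite /frobenius -mxtraceD; apply: is_derive_sumr => i _.
by have /is_derive_mxP := is_derive_mulmx fx (is_derive_trmx gx).
Qed.

End MatrixDerivatives.

Lemma is_derive_comp_curve (R : realType) (V W : normedModType R)
    (F : V -> W) (g : R -> V) (t : R) (X : V) :
  is_derive t 1 g X -> differentiable F (g t) ->
  is_derive t 1 (F \o g) ('D_X F (g t)).
Proof.
move=> [/derivable1_diffP dg <-] dF.
have dFg : differentiable (F \o g) t by exact: differentiable_comp.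
apply: DeriveDef; first exact/derivable1_diffP.
by rewrite !deriveE// diff_comp.
Qed.

(** * The Frobenius inner product and the action of pairs of orthogonal matrices *)

Section Frobenius.
Variables (R : realType) (d m : nat).
Implicit Types A B C : 'M[R]_(d, m).

Lemma frobeniusE A B : frobenius A B = \sum_i \sum_j A i j * B i j.
Proof.
by apply: eq_bigr => i _; rewrite mxE; apply: eq_bigr => j _; rewrite mxE.
Qed.

Lemma frobeniusC A B : frobenius A B = frobenius B A.
Proof. by rewrite /frobenius -mxtrace_tr trmx_mul trmxK. Qed.

Lemma frobeniusDl A B C : frobenius (A + B) C = frobenius A C + frobenius B C.
Proof. by rewrite /frobenius mulmxDl mxtraceD. Qed.

Lemma frobeniusNl A C : frobenius (- A) C = - frobenius A C.
Proof. by rewrite /frobenius mulNmx raddfN. Qed.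

Lemma frobeniusZl a A C : frobenius (a *: A) C = a * frobenius A C.
Proof. by rewrite /frobenius -scalemxAl mxtraceZ. Qed.

Lemma frobenius0l C : frobenius 0 C = 0.
Proof. by rewrite /frobenius mul0mx mxtrace0. Qed.

Lemma frobenius_suml (I : Type) (s : seq I) (P : pred I) (F : I -> 'M[R]_(d, m)) C :
  frobenius (\sum_(i <- s | P i) F i) C = \sum_(i <- s | P i) frobenius (F i) C.
Proof. by rewrite /frobenius mulmx_suml raddf_sum. Qed.

Lemma frobenius_sqr_ge A i j : A i j ^+ 2 <= frobenius A A.
Proof.
rewrite frobeniusE (bigD1 i)//= (bigD1 j)//= -expr2 -addrA lerDl.
by apply: addr_ge0; do ?[apply: sumr_ge0 => ? _]; rewrite // -expr2 sqr_ge0.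
Qed.

Lemma frobenius_delta A i j : frobenius A (delta_mx i j) = A i j.
Proof.
rewrite frobeniusE (bigD1 i)//= (bigD1 j)//= !mxE !eqxx mulr1.
rewrite big1 ?addr0 => [|l /negbTE lj]; last by rewrite mxE lj andbF mulr0.
rewrite big1 ?addr0// => l /negbTE li.
by rewrite big1 // => k _; rewrite mxE li mulr0.
Qed.

End Frobenius.

Definition biact (R : realType) (d m : nat) (U : 'M[R]_d) (V : 'M[R]_m)
  (A : 'M[R]_(d, m)) : 'M[R]_(d, m) := U *m A *m V^T.

Section Action.
Variables (R : realType) (d m : nat).
Implicit Types (A B C N X Y Z : 'M[R]_(d, m)) (U : 'M[R]_d) (V : 'M[R]_m).

Lemma orthogonal_tr k (U : 'M[R]_k) : orthogonal_group U -> orthogonal_group U^T.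
Proof. by rewrite /orthogonal_group/= trmxK => /mulmx1C. Qed.

Lemma orthogonal_trK k (U : 'M[R]_k) : orthogonal_group U -> U^T *m U = 1%:M.
Proof. by move=> /mulmx1C. Qed.

Lemma orthogonal1 k : orthogonal_group (1%:M : 'M[R]_k).
Proof. by rewrite /orthogonal_group/= trmx1 mulmx1. Qed.

Lemma orthogonalM k (U U' : 'M[R]_k) :
  orthogonal_group U -> orthogonal_group U' -> orthogonal_group (U *m U').
Proof.
rewrite /orthogonal_group/= trmx_mul => hU hU'.
by rewrite mulmxA -(mulmxA U) hU' mulmx1.
Qed.

Lemma biactM U U' V V' A : biact U V (biact U' V' A) = biact (U *m U') (V *m V') A.
Proof. by rewrite /biact trmx_mul !mulmxA. Qed.

Lemma biact1 A : biact 1%:M 1%:M A = A.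
Proof. by rewrite /biact trmx1 mulmx1 mul1mx. Qed.

Lemma biactK U V A : orthogonal_group U -> orthogonal_group V ->
  biact U^T V^T (biact U V A) = A.
Proof. by move=> hU hV; rewrite biactM !orthogonal_trK// biact1. Qed.

Lemma biactKV U V A : orthogonal_group U -> orthogonal_group V ->
  biact U V (biact U^T V^T A) = A.
Proof. by move=> hU hV; rewrite biactM hU hV biact1. Qed.

Lemma biactN U V A : biact U V (- A) = - biact U V A.
Proof. by rewrite /biact mulmxN mulNmx. Qed.

Lemma biactB U V A B : biact U V (A - B) = biact U V A - biact U V B.
Proof. by rewrite /biact mulmxBr mulmxBl. Qed.

Lemma biactZ U V a A : biact U V (a *: A) = a *: biact U V A.
Proof. by rewrite /biact -scalemxAr -scalemxAl. Qed.

Lemma biact_sum U V (I : Type) (s : seq I) (P : pred I) (F : I -> 'M[R]_(d, m)) :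
  biact U V (\sum_(i <- s | P i) F i) = \sum_(i <- s | P i) biact U V (F i).
Proof. by rewrite /biact mulmx_sumr mulmx_suml. Qed.

Lemma frobenius_biactl U V A B :
  frobenius (biact U V A) B = frobenius A (biact U^T V^T B).
Proof.
rewrite /frobenius /biact !trmx_mul !trmxK -!mulmxA.
by rewrite mxtrace_mulC !mulmxA.
Qed.

Lemma frobenius_biact U V A B : orthogonal_group U -> orthogonal_group V ->
  frobenius (biact U V A) (biact U V B) = frobenius A B.
Proof. by move=> hU hV; rewrite frobenius_biactl biactK. Qed.

Lemma cvg_biact (T : Type) (F : set_system T) {FF : Filter F}
    (f : T -> 'M[R]_(d, m)) A U V :
  f @ F --> A -> (fun t => biact U V (f t)) @ F --> biact U V A.
Proof.
by move=> fA; apply: cvg_mulmx; [apply: cvg_mulmx|]; do ?exact: cvg_cst.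
Qed.

Lemma orbit_biact B0 B U V : orthogonal_group U -> orthogonal_group V ->
  orbit_mx B0 B -> orbit_mx B0 (biact U V B).
Proof.
move=> hU hV [U' [V' [hU' hV' ->]]]; exists (U *m U'), (V *m V').
by split; [exact: orthogonalM|exact: orthogonalM|exact: biactM].
Qed.

Lemma orbit_refl B : orbit_mx B B.
Proof.
by exists 1%:M, 1%:M; split; [exact: orthogonal1..|rewrite -[LHS]biact1].
Qed.

End Action.

(** * Velocities of curves in the orthogonal group *)

Section OrthogonalCurves.
Variable (R : realType).

Definition skew k (u : 'M[R]_k) := u^T = - u.

(** The Lie algebra of the orthogonal group, defined by curves differentiable at
    one point; this is all that a tangent vector of the orbit requires. *)
Definition orthogonal_velocity k (u : 'M[R]_k) :=
  exists U : R -> 'M[R]_k,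
    [/\ forall s, orthogonal_group (U s), U 0 = 1%:M & is_derive (0 : R) (1 : R) U u].

Lemma orthogonal_velocity0 k : orthogonal_velocity (0 : 'M[R]_k).
Proof. by exists (fun=> 1%:M); split=> [s||]; [exact: orthogonal1|by []|exact: is_derive_cst]. Qed.

Lemma orthogonal_velocityD k (u v : 'M[R]_k) :
  orthogonal_velocity u -> orthogonal_velocity v -> orthogonal_velocity (u + v).
Proof.
move=> [U [hU U0 dU]] [V [hV V0 dV]]; exists (fun s => U s *m V s); split.
- by move=> s; exact: orthogonalM.
- by rewrite U0 V0 mulmx1.
- by apply: is_derive_eq (is_derive_mulmx dU dV) _; rewrite U0 V0 mulmx1 mul1mx.
Qed.

(** The rotation in the plane of the coordinates [i] and [j] is
    [1 + (cos - 1) K + sin J], where [J] generates it and [K = - J ^ 2] is the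
    projection onto that plane. *)
Lemma rotation_velocity k (i j : 'I_k) (a : R) :
  orthogonal_velocity (a *: (delta_mx i j - delta_mx j i)).
Proof.
have [->|ij] := eqVneq i j; first by rewrite subrr scaler0; exact: orthogonal_velocity0.
set J := delta_mx i j - delta_mx j i : 'M[R]_k.
pose K := delta_mx i i + delta_mx j j : 'M[R]_k.
have JT : J^T = - J by rewrite /J linearB/= !trmx_delta opprB.
have KT : K^T = K by rewrite /K linearD/= !trmx_delta.
have ji : (j == i) = false by rewrite eq_sym (negbTE ij).
have JJ : J *m J = - K.
  rewrite /J /K mulmxBl !mulmxBr !mul_delta_mx_cond !eqxx ji (negbTE ij) !mulr1n !mulr0n.
  by rewrite sub0r subr0 opprD.
have KK : K *m K = K.
  rewrite /K mulmxDl !mulmxDr !mul_delta_mx_cond !eqxx ji (negbTE ij) !mulr1n !mulr0n.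
  by rewrite addr0 add0r.
have KJ : K *m J = J.
  rewrite /J /K mulmxDl !mulmxBr !mul_delta_mx_cond !eqxx ji (negbTE ij) !mulr1n !mulr0n.
  by rewrite subr0 sub0r.
have JK : J *m K = J.
  rewrite /J /K mulmxBl !mulmxDr !mul_delta_mx_cond !eqxx ji (negbTE ij) !mulr1n !mulr0n.
  by rewrite addr0 add0r.
clearbody J K.
exists (fun s => 1%:M + (cos (a * s) - 1) *: K + sin (a * s) *: J); split.
- move=> s; rewrite /orthogonal_group/= !linearD/= !linearZ/= trmx1 KT JT.
  have := cos2Dsin2 (a * s); move: (cos _) (sin _) => c e ce.
  rewrite !mulmxDl !mulmx1 !mul1mx -!scalemxAl !mulmxN.
  rewrite KK KJ JK JJ opprK.
  apply/matrixP => x y; rewrite !mxE.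
  have z : K x y * (c ^+ 2 + e ^+ 2 - 1) = 0 by rewrite ce subrr mulr0.
  by rewrite -[RHS]addr0 -z; ring.
- by rewrite mulr0 cos0 sin0 subrr !scale0r !addr0.
- apply/is_derive_mxP => x y; rewrite mxE.
  have cst_drv (b : R) : is_derive (0 : R) (1 : R) (fun=> b) 0 by exact: is_derive_cst.
  have id_drv : is_derive (0 : R) (1 : R) (fun s => s) 1 by exact: is_derive_id.
  have da : is_derive (0 : R) (1 : R) (fun s => a * s) a.
    by apply: is_derive_eq (is_derive_mulr (cst_drv a) id_drv) _; rewrite mul0r add0r mulr1.
  have dc : is_derive (0 : R) (1 : R) (fun s => cos (a * s)) 0.
    apply: is_derive_eq (is_derive1_comp (f := cos) (is_derive_cos _) da) _.
    by rewrite mulr0 sin0 oppr0 mul0r.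
  have ds : is_derive (0 : R) (1 : R) (fun s => sin (a * s)) a.
    apply: is_derive_eq (is_derive1_comp (f := sin) (is_derive_sin _) da) _.
    by rewrite mulr0 cos0 mul1r.
  under eq_fun do rewrite !mxE.
  have dK := is_derive_mulr (is_deriveB dc (cst_drv 1)) (cst_drv (K x y)).
  have dJ := is_derive_mulr ds (cst_drv (J x y)).
  apply: is_derive_eq (is_deriveD (is_deriveD (cst_drv (x == y)%:R) dK) dJ) _.
  by rewrite subr0 !mul0r !mulr0 !add0r addr0.
Qed.

(** Skew matrices are sums of generators of plane rotations, and the product of two
    curves through the identity has the sum of their velocities. *)
Lemma skew_velocity k (u : 'M[R]_k) : skew u -> orthogonal_velocity u.
Proof.
move=> hu.
have -> : u = \sum_i \sum_j (u i j / 2) *: (delta_mx i j - delta_mx j i).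
  have uT : u^T = \sum_i \sum_j u i j *: delta_mx j i.
    rewrite {1}(matrix_sum_delta u) linear_sum; apply: eq_bigr => i _.
    by rewrite linear_sum; apply: eq_bigr => j _; rewrite linearZ/= trmx_delta.
  transitivity (2^-1 *: (u - u^T)).
    by rewrite hu opprK -mulr2n -[u *+ 2]scaler_nat scalerA mulVf ?pnatr_eq0// scale1r.
  rewrite {1}(matrix_sum_delta u) uT -sumrB scaler_sumr; apply: eq_bigr => i _.
  rewrite -sumrB scaler_sumr; apply: eq_bigr => j _.
  by rewrite -scalerBr scalerA mulrC.
elim/big_ind: _ => [|a b|i _]; [exact: orthogonal_velocity0|exact: orthogonal_velocityD|].
elim/big_ind: _ => [|a b|j _]; [exact: orthogonal_velocity0|exact: orthogonal_velocityD|].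
exact: rotation_velocity.
Qed.

Lemma symmetric_of_orth_skew k (G : 'M[R]_k) :
  (forall u, skew u -> \tr (u *m G) = 0) -> G^T = G.
Proof.
move=> hG; apply/matrixP => i j.
have /hG : skew (delta_mx i j - delta_mx j i : 'M[R]_k).
  by rewrite /skew linearB/= !trmx_delta opprB.
have trd (a b : 'I_k) : \tr (delta_mx a b *m G) = G b a.
  rewrite /mxtrace (bigD1 a)//= mxE (bigD1 b)//= mxE !eqxx mul1r.
  rewrite big1 ?addr0 => [|l /negbTE lb]; last by rewrite mxE lb andbF mul0r.
  rewrite big1 ?addr0// => l /negbTE la; rewrite mxE big1// => x _.
  by rewrite mxE la mul0r.
rewrite mulmxBl linearB/= !trd => /eqP; rewrite subr_eq0 => /eqP <-.
by rewrite mxE.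
Qed.

End OrthogonalCurves.

(** * Tangent vectors and curvature of orbits *)

Section Orbits.
Variables (R : realType) (d m : nat).
Implicit Types (A B N X Y Z : 'M[R]_(d, m)) (u : 'M[R]_d) (v : 'M[R]_m).

(** The velocity at [0] of [U(s) A V(s)^T] when [U] and [V] leave the identity
    with velocities [u] and [v]. *)
Definition infact u v A : 'M[R]_(d, m) := u *m A + A *m v^T.

Lemma is_derive_biact (U : R -> 'M[R]_d) (V : R -> 'M[R]_m)
    (g : R -> 'M[R]_(d, m)) u v X :
  U 0 = 1%:M -> V 0 = 1%:M -> is_derive (0 : R) (1 : R) U u ->
  is_derive (0 : R) (1 : R) V v -> is_derive (0 : R) (1 : R) g X ->
  is_derive (0 : R) (1 : R) (fun s => biact (U s) (V s) (g s))
    (infact u v (g 0) + X).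
Proof.
move=> U0 V0 dU dV dg.
apply: is_derive_eq (is_derive_mulmx (is_derive_mulmx dU dg) (is_derive_trmx dV)) _.
by rewrite /infact U0 V0 trmx1 !mulmx1 !mul1mx addrAC.
Qed.

Lemma is_derive_cstmx p q (C : 'M[R]_(p, q)) : is_derive (0 : R) (1 : R) (fun=> C) 0.
Proof. exact: is_derive_cst. Qed.

Lemma infact_tangent B0 B u v : orbit_mx B0 B -> skew u -> skew v ->
  tangent_space (orbit_mx B0) B (infact u v B).
Proof.
move=> SB /skew_velocity[U [hU U0 dU]] /skew_velocity[V [hV V0 dV]].
exists (fun s => biact (U s) (V s) B); split.
- by move=> s; exact: orbit_biact.
- by rewrite U0 V0 biact1.
- by apply: is_derive_eq (is_derive_biact U0 V0 dU dV (is_derive_cstmx B)) _; rewrite addr0.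
Qed.

Lemma tangent_biact B0 B U V X : orthogonal_group U -> orthogonal_group V ->
  tangent_space (orbit_mx B0) B X ->
  tangent_space (orbit_mx B0) (biact U V B) (biact U V X).
Proof.
move=> hU hV [g [Sg g0 dg]]; exists (fun s => biact U V (g s)); split.
- by move=> s; exact: orbit_biact.
- by rewrite g0.
- apply: is_derive_eq (is_derive_mulmx (is_derive_mulmx (is_derive_cstmx U) dg)
    (is_derive_cstmx V^T)) _.
  by rewrite mul0mx mulmx0 add0r addr0.
Qed.

Lemma second_fundamental_form_normal (S : set 'M[R]_(d, m)) A X Y Z :
  tangent_space S A Z -> frobenius (second_fundamental_form S A X Y) Z = 0.
Proof.
move=> TZ; rewrite /second_fundamental_form; case: xgetP => [N _|_]; last exact: frobenius0l.
by case=> F [_ _ _ [hN _]]; exact: hN.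
Qed.

(** Each second fundamental form in the trace is a normal component or the default
    value [0], and likewise for the trace itself; so this holds at every matrix,
    whatever its singular values. *)
Lemma mean_curvature_normal (S : set 'M[R]_(d, m)) A Z :
  tangent_space S A Z -> frobenius (mean_curvature S A) Z = 0.
Proof.
move=> TZ; rewrite /mean_curvature; case: xgetP => [h _|_]; last exact: frobenius0l.
case=> k [e [_ ->]]; rewrite frobenius_suml big1// => i _.
exact: second_fundamental_form_normal.
Qed.

(** A normal vector [Z] at [A] stays normal when carried along the curve
    [U(s) A V(s)^T] by the same orthogonal matrices, so its inner product with a
    tangent field vanishes identically; the derivative of that product at [0]
    expresses the second fundamental form by first-order data. *)
Lemma second_fundamental_form_pairing A u v (F : 'M[R]_(d, m) -> 'M[R]_(d, m)) N Z :
  let S := orbit_mx A in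
  skew u -> skew v ->
  differentiable F A ->
  (\forall B \near A, S B -> tangent_space S B (F B)) ->
  normal_component (tangent_space S A) ('D_(infact u v A) F A) N ->
  (forall X, tangent_space S A X -> frobenius X Z = 0) ->
  frobenius N Z = - frobenius (F A) (infact u v Z).
Proof.
move=> S /skew_velocity[U [hU U0 dU]] /skew_velocity[V [hV V0 dV]] dF FT [_ WN] hZ.
pose g s := biact (U s) (V s) A.
have g0 : g 0 = A by rewrite /g U0 V0 biact1.
have dg : is_derive (0 : R) (1 : R) g (infact u v A).
  by apply: is_derive_eq (is_derive_biact U0 V0 dU dV (is_derive_cstmx A)) _; rewrite addr0.
have dFg : is_derive (0 : R) (1 : R) (F \o g) ('D_(infact u v A) F A).
  by have := is_derive_comp_curve (F := F) dg; rewrite g0; exact.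
have dZ := is_derive_biact U0 V0 dU dV (is_derive_cstmx Z).
have dp := is_derive_frobenius dFg dZ.
have gA : g @ (0 : R) --> A.
  rewrite -[X in _ --> X]g0; case: dg => /derivable1_diffP dg _.
  exact: (differentiable_continuous dg).
have p0 : \forall s \near (0 : R), frobenius ((F \o g) s) (biact (U s) (V s) Z) = 0.
  near=> s.
  have Sg : S (g s) by apply: orbit_biact => //; exact: orbit_refl.
  have TF : tangent_space S (g s) (F (g s)).
    move: Sg; near: s; exact: gA FT.
  have := tangent_biact (orthogonal_tr (hU s)) (orthogonal_tr (hV s)) TF.
  rewrite biactK// => /hZ; rewrite frobenius_biactl !trmxK; exact.
have := near_eq_is_derive p0 dp => -[_].
rewrite derive_cst => /esym/eqP.
rewrite /= g0 U0 V0 biact1 addr0 addr_eq0 => /eqP DN.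
move/hZ: WN; rewrite frobeniusDl frobeniusNl DN => /eqP.
by rewrite subr_eq0 => /eqP ->.
Unshelve. all: by end_near. Qed.

(** Testing against [u B] and [B v^T] gives the orthogonality of [N B^T] and
    [B^T N] to all skew matrices. *)
Lemma normal_symmetric B0 B N : orbit_mx B0 B ->
  (forall X, tangent_space (orbit_mx B0) B X -> frobenius N X = 0) ->
  (N *m B^T)^T = N *m B^T /\ (B^T *m N)^T = B^T *m N.
Proof.
move=> SB hN; split; apply: symmetric_of_orth_skew => u hu.
  have h0 : skew (0 : 'M[R]_m) by rewrite /skew trmx0 oppr0.
  have /hN := infact_tangent SB hu h0.
  rewrite /infact trmx0 mulmx0 addr0 /frobenius trmx_mul hu !mulmxN linearN/=.
  by rewrite (mulmxA N) => /eqP; rewrite oppr_eq0 => /eqP <-; exact: mxtrace_mulC.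
have h0 : skew (0 : 'M[R]_d) by rewrite /skew trmx0 oppr0.
have /hN := infact_tangent SB h0 hu.
by rewrite /infact mul0mx add0r /frobenius trmx_mul trmxK mxtrace_mulC mulmxA.
Qed.

End Orbits.
(** * Matrices related by two symmetry conditions *)

Section SymmetricPairs.
Variables (R : realType).

Definition offdiag k (C : 'M[R]_k) : 'M[R]_k :=
  \matrix_(i, j) if i == j then 0 else C i j.

(** The two conditions say that [N] is orthogonal to the orbit directions at
    [C].  When [C] is diagonal the right-hand side vanishes, and so does every
    off-diagonal entry of [N] between unequal squares; in general these entries
    are controlled by the off-diagonal entries of [C]. *)
Lemma symmetric_pair_entry k (N C : 'M[R]_k) i j :
  let E := offdiag C in
  (N *m C^T)^T = N *m C^T -> (C^T *m N)^T = C^T *m N ->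
  N i j * (C i i ^+ 2 - C j j ^+ 2) =
    C i i * ((E^T *m N) j i - (E^T *m N) i j)
    - C j j * ((N *m E^T) j i - (N *m E^T) i j).
Proof.
move=> E /matrixP/(_ j i) h1 /matrixP/(_ j i) h2.
have CE : C^T = E^T + diag_mx (\row_l C l l).
  apply/matrixP => a b; rewrite !mxE.
  by case: (eqVneq a b) => [->|_]; rewrite ?mulr1n ?mulr0n ?add0r ?addr0.
have NC a b : (N *m C^T) a b = N a b * C b b + (N *m E^T) a b.
  by rewrite CE mulmxDr mul_mx_diag [LHS]mxE addrC [X in X + _]mxE mxE.
have CN a b : (C^T *m N) a b = C a a * N a b + (E^T *m N) a b.
  by rewrite CE mulmxDl mul_diag_mx [LHS]mxE addrC [X in X + _]mxE mxE.
move: h1 h2; rewrite mxE [in X in _ -> X -> _]mxE !NC !CN => h1 h2.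
have e1 : N i j * C j j = N j i * C i i + (N *m E^T) j i - (N *m E^T) i j.
  by rewrite -h1 addrK.
have e2 : C i i * N i j = C j j * N j i + (E^T *m N) j i - (E^T *m N) i j.
  by rewrite -h2 addrK.
transitivity (C i i * (C i i * N i j) - C j j * (N i j * C j j)); first by ring.
by rewrite e1 e2; ring.
Qed.

End SymmetricPairs.

(** * Rectangular diagonal matrices *)

Section Rectangular.
Variables (R : realType) (d m : nat) (hdm : (d <= m)%N).
Implicit Types (A B C N X Z : 'M[R]_(d, m)) (r c : 'rV[R]_d).

Definition rdiag c : 'M[R]_(d, m) := diag_mx c *m pid_mx d.

Definition wide (i : 'I_d) : 'I_m := widen_ord hdm i.

Definition rdiagonal A : 'rV[R]_d := \row_i A i (wide i).

(** Rectangular matrices are completed to square ones by zero rows, so that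
    singular values and extra zero columns are treated alike. *)
Definition pad A : 'M[R]_m := pid_mx d *m A.

Definition regular r : Prop :=
  (forall i, 0 < r 0 i) /\ (forall i j, i != j -> r 0 i != r 0 j).

Lemma wide_inj : injective wide.
Proof. by move=> i j /(congr1 val)/= /val_inj. Qed.

Variant wide_spec (j : 'I_m) : Type :=
| WideIn i of j = wide i : wide_spec j
| WideOut of (d <= j)%N : wide_spec j.

Lemma wideP j : wide_spec j.
Proof.
case: (ltnP j d) => jd; last exact: WideOut.
by apply: (@WideIn _ (Ordinal jd)); apply: val_inj.
Qed.

Lemma rdiagE c i j : rdiag c i j = c 0 i *+ (j == wide i).
Proof.
rewrite mxE (bigD1 i)//= !mxE eqxx mulr1n ltn_ord andbT big1 ?addr0.
  by rewrite mulr_natr; congr (_ *+ nat_of_bool _); rewrite [RHS]eq_sym.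
by move=> k /negbTE ki; rewrite !mxE eq_sym ki mulr0n mul0r.
Qed.

Lemma rdiagonalK : cancel rdiag rdiagonal.
Proof. by move=> c; apply/rowP => i; rewrite mxE rdiagE eqxx. Qed.

Lemma rdiagB c c' : rdiag (c - c') = rdiag c - rdiag c'.
Proof. by rewrite /rdiag linearB/= mulmxBl. Qed.

Lemma rdiagN c : rdiag (- c) = - rdiag c.
Proof. by rewrite /rdiag linearN/= mulNmx. Qed.

Lemma frobenius_rdiag A c : frobenius A (rdiag c) = \sum_i A i (wide i) * c 0 i.
Proof.
rewrite frobeniusE; apply: eq_bigr => i _.
rewrite (bigD1 (wide i))//= rdiagE eqxx big1 ?addr0// => j /negbTE ji.
by rewrite rdiagE ji mulr0.
Qed.

Lemma pid_pid : (pid_mx d : 'M[R]_(d, m)) *m (pid_mx d : 'M[R]_(m, d)) = 1%:M.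
Proof. by rewrite pid_mx_id// pid_mx_1. Qed.

Lemma padE A i j : pad A (wide i) j = A i j.
Proof.
rewrite mxE (bigD1 i)//= !mxE eqxx /= ltn_ord mul1r big1 ?addr0// => k /negbTE ki.
by rewrite mxE /= [(_ == _ :> nat)]eq_sym [(_ == _ :> nat)]ki mul0r.
Qed.

Lemma pad_out A (i j : 'I_m) : (d <= i)%N -> pad A i j = 0.
Proof. by move=> di; rewrite mxE big1// => k _; rewrite mxE ltnNge di andbF mul0r. Qed.

Lemma pad_rdiag r (i j : 'I_m) : i != j -> pad (rdiag r) i j = 0.
Proof.
case: (wideP i) => [k ->|ik _]; last by rewrite pad_out.
by rewrite padE rdiagE eq_sym => /negbTE ->.
Qed.

Lemma offdiag_pad_rdiag r : offdiag (pad (rdiag r)) = 0.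
Proof. by apply/matrixP => i j; rewrite [LHS]mxE [RHS]mxE; case: eqVneq => // /pad_rdiag ->. Qed.

Lemma regular_sqr_neq r i j : regular r -> j != wide i ->
  r 0 i ^+ 2 - pad (rdiag r) j j ^+ 2 != 0.
Proof.
move=> [r0 rd]; rewrite subr_eq0; case: (wideP j) => [k ->|jd _].
  rewrite padE rdiagE eqxx mulr1n => ik; rewrite eqrXn2 ?ltW//; apply: rd.
  by apply: contraNneq ik => ->.
by rewrite pad_out// expr0n/= sqrf_eq0 gt_eqF.
Qed.

Lemma pad_symmetric_pair N C :
  (N *m C^T)^T = N *m C^T -> (C^T *m N)^T = C^T *m N ->
  (pad N *m (pad C)^T)^T = pad N *m (pad C)^T /\
  ((pad C)^T *m pad N)^T = (pad C)^T *m pad N.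
Proof.
move=> h1 h2.
have -> : pad N *m (pad C)^T = pid_mx d *m (N *m C^T) *m pid_mx d.
  by rewrite /pad trmx_mul tr_pid_mx !mulmxA.
have -> : (pad C)^T *m pad N = C^T *m N.
  rewrite /pad trmx_mul tr_pid_mx !mulmxA.
  by rewrite -(mulmxA C^T) pid_pid mulmx1.
by split=> //; rewrite trmx_mul tr_pid_mx (trmx_mul (pid_mx d)) tr_pid_mx h1 mulmxA.
Qed.

(** By [symmetric_pair_entry] for the padded matrices: the squares of the padded
    diagonal are distinct as soon as one of the two indices is less than [d]. *)
Lemma normal_at_rdiag r N : regular r ->
  (N *m (rdiag r)^T)^T = N *m (rdiag r)^T ->
  ((rdiag r)^T *m N)^T = (rdiag r)^T *m N ->
  N = rdiag (rdiagonal N).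
Proof.
move=> hr h1 h2; have [p1 p2] := pad_symmetric_pair h1 h2.
apply/matrixP => i j; rewrite rdiagE mxE; have [->//|ji] := eqVneq.
have := symmetric_pair_entry (wide i) j p1 p2.
have z a b : (0 : 'M[R]_m) a b = 0 by rewrite mxE.
rewrite offdiag_pad_rdiag trmx0 mulmx0 mul0mx !z subrr !mulr0 subr0.
rewrite !padE rdiagE eqxx mulr1n => /eqP; rewrite mulf_eq0 => /orP[/eqP->//|].
by rewrite (negbTE (regular_sqr_neq hr ji)).
Qed.

End Rectangular.

(** * The point of an orbit nearest to a diagonal matrix *)

Section Nearest.
Variables (R : realType) (d m : nat).
Implicit Types (A B C D N X Z : 'M[R]_(d, m)) (U : 'M[R]_d) (V : 'M[R]_m).

Lemma orthogonal_entry_le1 k (U : 'M[R]_k) i j : orthogonal_group U -> `|U i j| <= 1.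
Proof.
move=> /matrixP/(_ i i); rewrite !mxE eqxx mulr1n => h.
rewrite -(@expr_le1 _ 2)// real_normK ?num_real// -{}h.
by rewrite (bigD1 j)//= mxE -expr2 lerDl sumr_ge0// => l _; rewrite mxE -expr2 sqr_ge0.
Qed.

Lemma closed_orthogonal (T : topologicalType) k (f : T -> 'M[R]_k) :
  (forall t, f @ t --> f t) -> closed [set t | orthogonal_group (f t)].
Proof.
move=> cf; apply: (@preimage_closed _ _ (fun t => f t *m (f t)^T) [set 1%:M]).
  by move=> t _; apply: cvg_mulmx; [exact: cf|apply: cvg_trmx; exact: cf].
exact/accessible_closed_set1/hausdorff_accessible/norm_hausdorff.
Qed.

(** The orbit is the continuous image of the compact set of pairs of orthogonal
    matrices, which is encoded as a set of row vectors. *)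
Lemma orbit_attains_max B D : exists U V,
  [/\ orthogonal_group U, orthogonal_group V &
   forall U' V', orthogonal_group U' -> orthogonal_group V' ->
     frobenius (biact U' V' B) D <= frobenius (biact U V B) D].
Proof.
pose fU (w : 'rV[R]_(d * d + m * m)) : 'M[R]_d := vec_mx (lsubmx w).
pose fV (w : 'rV[R]_(d * d + m * m)) : 'M[R]_m := vec_mx (rsubmx w).
have cU w : fU @ w --> fU w.
  apply/(cvg_mxP (F := nbhs w)) => i j; rewrite /fU !mxE; under eq_fun do rewrite !mxE.
  exact: coord_continuous.
have cV w : fV @ w --> fV w.
  apply/(cvg_mxP (F := nbhs w)) => i j; rewrite /fV !mxE; under eq_fun do rewrite !mxE.
  exact: coord_continuous.
pose K := [set w | orthogonal_group (fU w)] `&` [set w | orthogonal_group (fV w)].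
pose enc (U : 'M[R]_d) (V : 'M[R]_m) := row_mx (mxvec U) (mxvec V).
have encU U V : fU (enc U V) = U by rewrite /fU /enc row_mxKl mxvecK.
have encV U V : fV (enc U V) = V by rewrite /fV /enc row_mxKr mxvecK.
have K0 : K !=set0.
  by exists (enc 1%:M 1%:M); split; rewrite /= ?encU ?encV; exact: orthogonal1.
have cK : compact K.
  apply: bounded_closed_compact; last by apply: closedI; exact: closed_orthogonal.
  exists 1; split => // M M1 w [wU wV].
  rewrite /Num.Def.normr/= mx_normrE (bigmax_le _ (ltW (lt_trans ltr01 M1)))//= => -[i k] _ /=.
  apply: (le_trans _ (ltW M1)); rewrite (ord1 i); case: (split_ordP k) => l ->.
    case/mxvec_indexP: l => a b; have := orthogonal_entry_le1 a b wU.
    by rewrite /fU !mxE.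
  case/mxvec_indexP: l => a b; have := orthogonal_entry_le1 a b wV.
  by rewrite /fV !mxE.
have cont (w : 'rV[R]_(d * d + m * m)) :
    (fun w => frobenius (biact (fU w) (fV w) B) D) @ nbhs w
      --> frobenius (biact (fU w) (fV w) B) D.
  apply: (cvg_frobenius (F := nbhs w)); last exact: cvg_cst.
  apply: (cvg_mulmx (F := nbhs w)); last exact: cvg_trmx (cV w).
  by apply: (cvg_mulmx (F := nbhs w)); [exact: cU|exact: cvg_cst].
have [|w wK wmax] := EVT_max_rV (f := fun w => frobenius (biact (fU w) (fV w) B) D) K0 cK.
  by apply: continuous_subspaceT => w; exact: cont.
rewrite inE in wK; exists (fU w), (fV w); case: (wK) => wU wV; split=> // U' V' hU hV.
have := wmax (enc U' V'); rewrite encU encV; apply.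
by rewrite inE; split; rewrite /= ?encU ?encV.
Qed.

Lemma is_derive_at_max (f : R -> R) (c L : R) :
  is_derive c (1 : R) f L -> (forall t, f t <= f c) -> L = 0.
Proof.
move=> [df <-] fmax.
have dq : (fun h => h^-1 *: (f (h *: 1 + c) - f c)) @ (0 : R)^' --> 'D_1 f c := df.
apply/eqP; case: (ltrgt0P ('D_1 f c)) => // L0; exfalso.
  have [e /= e0 he] := cvgr_gt _ dq _ L0.
  have e2 : 0 < e / 2 by lra.
  have : 0 < (e / 2)^-1 * (f ((e / 2) *: 1 + c) - f c).
    by apply: he; rewrite ?lt0r_neq0//= sub0r normrN gtr0_norm//; lra.
  by rewrite pmulr_rgt0 ?invr_gt0// subr_gt0 ltNge fmax.
have [e /= e0 he] := cvgr_lt _ dq _ L0.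
have e2 : 0 < e / 2 by lra.
have : (- (e / 2))^-1 * (f (- (e / 2) *: 1 + c) - f c) < 0.
  by apply: he; rewrite ?oppr_eq0 ?lt0r_neq0//= opprK add0r gtr0_norm//; lra.
by rewrite invrN mulNr oppr_lt0 pmulr_rgt0 ?invr_gt0// subr_gt0 ltNge fmax.
Qed.

(** At a maximum point [M] of [<., D>] on an orbit the derivative [<u M + M v^T, D>]
    vanishes for all skew [u] and [v]. *)
Lemma max_normal M D :
  (forall U V, orthogonal_group U -> orthogonal_group V ->
     frobenius (biact U V M) D <= frobenius M D) ->
  (M *m D^T)^T = M *m D^T /\ (D^T *m M)^T = D^T *m M.
Proof.
move=> hM.
have crit u v : skew u -> skew v -> frobenius (infact u v M) D = 0.
  move=> /skew_velocity[U [hU U0 dU]] /skew_velocity[V [hV V0 dV]].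
  have dM := is_derive_biact U0 V0 dU dV (is_derive_cstmx M).
  have df := is_derive_frobenius dM (is_derive_cstmx D).
  have df0 : is_derive (0 : R) (1 : R)
      (fun s => frobenius (biact (U s) (V s) M) D) (frobenius (infact u v M) D).
    apply: is_derive_eq df _.
    by rewrite addr0 [frobenius _ 0]frobeniusC frobenius0l addr0.
  by apply: is_derive_at_max df0 _ => s; rewrite U0 V0 biact1; exact: hM.
have h0 k : skew (0 : 'M[R]_k) by rewrite /skew trmx0 oppr0.
split; apply: symmetric_of_orth_skew => u hu.
  by have := crit u 0 hu (h0 m); rewrite /infact trmx0 mulmx0 addr0 /frobenius mulmxA.
have := crit 0 u (h0 d) hu; rewrite /infact mul0mx add0r /frobenius hu mulmxN mulNmx linearN/=.
move=> /eqP; rewrite oppr_eq0 => /eqP <-.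
by rewrite mulmxA [RHS]mxtrace_mulC !mulmxA [RHS]mxtrace_mulC !mulmxA.
Qed.

(** The points of an orbit have the same norm, so the nearest one to [D_r] maximizes
    the inner product with [D_r].  It is then normal at [D_r], that is, diagonal.
    This yields a singular value decomposition of [B] together with a bound on the
    distance of the singular values from [r]. *)
Lemma nearest_rdiag (hdm : (d <= m)%N) B r : regular r -> exists U V c,
  [/\ orthogonal_group U, orthogonal_group V, biact U V B = rdiag m c &
   frobenius (rdiag m c - rdiag m r) (rdiag m c - rdiag m r)
     <= frobenius (B - rdiag m r) (B - rdiag m r)].
Proof.
move=> hr; have [U [V [hU hV hmax]]] := orbit_attains_max B (rdiag m r).
have [h1 h2] : ((biact U V B) *m (rdiag m r)^T)^T = (biact U V B) *m (rdiag m r)^T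
    /\ ((rdiag m r)^T *m (biact U V B))^T = (rdiag m r)^T *m (biact U V B).
  apply: max_normal => U' V' hU' hV'; rewrite biactM.
  by apply: hmax; exact: orthogonalM.
have BE := normal_at_rdiag hdm hr h1 h2.
exists U, V, (rdiagonal hdm (biact U V B)); split=> //; rewrite -BE.
have sqrB C : frobenius (C - rdiag m r) (C - rdiag m r) =
    frobenius C C - frobenius C (rdiag m r) *+ 2 + frobenius (rdiag m r) (rdiag m r).
  rewrite frobeniusDl frobeniusNl !(frobeniusC _ (C - _)) !frobeniusDl !frobeniusNl.
  by rewrite (frobeniusC (rdiag m r) C); ring.
rewrite !sqrB frobenius_biact// lerD2r lerD2l lerN2 lerMn2r/=.
by rewrite -{1}[B]biact1; apply: hmax; exact: orthogonal1.
Qed.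

End Nearest.

(** * The tangent space at a matrix with distinct positive singular values *)

Section SpectralChain.
Variable (R : realType) (d : nat).
Implicit Types (M U : 'M[R]_d) (c : 'rV[R]_d) (s : seq R).

(** The matrix polynomial with the list of roots [s], evaluated at [M]. *)
Definition chain M s : 'M[R]_d := foldr (fun a P => (M - a%:M) *m P) 1%:M s.

Lemma chain_conj U M s : orthogonal_group U ->
  chain (U *m M *m U^T) s = U *m chain M s *m U^T.
Proof.
move=> hU; elim: s => [|a s /= ->]; first by rewrite /= mulmx1 hU.
have -> : U *m M *m U^T - a%:M = U *m (M - a%:M) *m U^T.
  by rewrite mulmxBr mulmxBl scalar_mxC -[a%:M *m U *m _]mulmxA hU mulmx1.
by rewrite -!mulmxA (mulmxA U^T U) orthogonal_trK// mul1mx.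
Qed.

Lemma chain_diag c s :
  chain (diag_mx c) s = diag_mx (\row_i \prod_(a <- s) (c 0 i - a)).
Proof.
elim: s => [|a s /= ->].
  by apply/matrixP => i j; rewrite !mxE big_nil.
have -> : diag_mx c - a%:M = diag_mx (\row_i (c 0 i - a)).
  by apply/matrixP => i j; rewrite !mxE mulrnBl.
rewrite mulmx_diag; congr diag_mx; apply/rowP => i.
by rewrite !mxE big_cons.
Qed.

Lemma is_derive_chain (M : R -> 'M[R]_d) M' s :
  is_derive (0 : R) (1 : R) M M' ->
  exists L, is_derive (0 : R) (1 : R) (fun t => chain (M t) s) L.
Proof.
move=> dM; elim: s => [|a s [L dL]]; first by exists 0; exact: is_derive_cst.
have dMa := is_deriveB dM (is_derive_cstmx (a%:M : 'M[R]_d)).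
by eexists; exact: is_derive_mulmx dMa dL.
Qed.

End SpectralChain.

Lemma orbit_transitive (R : realType) (d m : nat) (B0 B C : 'M[R]_(d, m)) :
  orbit_mx B0 B -> orbit_mx B0 C ->
  exists U V, [/\ orthogonal_group U, orthogonal_group V & C = biact U V B].
Proof.
move=> [U [V [hU hV ->]]] [U' [V' [hU' hV' ->]]].
exists (U' *m U^T), (V' *m V^T); split.
- exact/orthogonalM/orthogonal_tr.
- exact/orthogonalM/orthogonal_tr.
- by rewrite -biactM -[U *m _ *m _]/(biact U V B0) biactK.
Qed.

Section TangentSpace.
Variables (R : realType) (d m : nat) (hdm : (d <= m)%N).
Implicit Types (A B C N X Z : 'M[R]_(d, m)) (r c z : 'rV[R]_d).

Notation wide := (wide hdm).
Notation rdiag := (rdiag m).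

Lemma rdiag_gram r : rdiag r *m (rdiag r)^T = diag_mx (\row_i (r 0 i ^+ 2)).
Proof.
rewrite /rdiag trmx_mul tr_pid_mx mulmxA -(mulmxA (diag_mx r)) pid_pid// mulmx1.
by rewrite tr_diag_mx mulmx_diag; congr diag_mx; apply/rowP => i; rewrite !mxE expr2.
Qed.

(** The Gram matrix [M = g g^T] of a point [g] of the orbit is conjugate to
    [diag(r^2)], so it is killed by the fixed polynomial
    [prod_j (M - r_j^2)].  Differentiating this identity along a curve, only the
    factor with index [k] contributes to the entry [(k, k)] at a diagonal
    matrix; hence the derivative of [M_kk], which is [2 r_k X_kk], is zero. *)
Lemma tangent_rdiagonal B0 r X k : regular r -> orbit_mx B0 (rdiag r) ->
  tangent_space (orbit_mx B0) (rdiag r) X -> X k (wide k) = 0.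
Proof.
move=> hr Sr [g [Sg g0 dg]].
pose M t := g t *m (g t)^T.
have dM := is_derive_mulmx dg (is_derive_trmx dg).
(* the factor with index [k] is split off and put first *)
pose s := [seq r 0 j ^+ 2 | j <- enum 'I_d & j != k].
have [L dL] := is_derive_chain s dM.
have zero t : chain (M t) (r 0 k ^+ 2 :: s) = 0.
  have [U [V [hU hV gE]]] := orbit_transitive Sr (Sg t).
  have -> : M t = U *m diag_mx (\row_i (r 0 i ^+ 2)) *m U^T.
    rewrite /M gE -rdiag_gram /biact !trmx_mul trmxK !mulmxA.
    by rewrite -(mulmxA _ V^T) orthogonal_trK// mulmx1.
  rewrite chain_conj// chain_diag; set D := diag_mx _.
  suff -> : D = 0 by rewrite mulmx0 mul0mx.
  apply/matrixP => i j; rewrite !mxE; suff -> : \prod_(a <- r 0 k ^+ 2 :: s) (r 0 i ^+ 2 - a) = 0 by rewrite mul0rn.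
  apply/eqP; rewrite big_cons mulf_eq0; have [->|ik] := eqVneq i k.
    by rewrite subrr eqxx.
  apply/orP; right; rewrite /s big_map big_filter prodf_seq_eq0.
  by apply/hasP; exists i; rewrite ?mem_enum//= ik subrr eqxx.
have dMk : is_derive (0 : R) (1 : R) (fun t => M t - (r 0 k ^+ 2)%:M)
    (X *m (g 0)^T + g 0 *m X^T).
  by apply: is_derive_eq (is_deriveB dM (is_derive_cstmx _)) _; rewrite subr0.
have := is_derive_mulmx dMk dL.
rewrite (_ : (fun t => _ *m _) = (fun=> 0)); last by apply/funext => t; exact: zero.
case=> _; rewrite derive_cst => /matrixP/(_ k k).
have M0 : M 0 = diag_mx (\row_i (r 0 i ^+ 2)) by rewrite /M g0 rdiag_gram.
rewrite /= -[g 0 *m (g 0)^T]/(M 0) M0 chain_diag !g0.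
rewrite mul_mx_diag [LHS]mxE [RHS]mxE [X in _ = X + _]mxE [in X in _ = _ + X]mxE.
rewrite [X in _ = _ + X]big1 ?addr0; last first.
  by move=> l _; rewrite !mxE; case: eqVneq => [->|_]; rewrite ?mulr1n ?mulr0n subrr mul0r.
rewrite [X in _ * X]mxE big_map big_filter => /esym/eqP; rewrite mulf_eq0 => /orP[|]; last first.
  rewrite prodf_seq_eq0 => /hasP[j _ /= /andP[jk]].
  by rewrite mxE subr_eq0 eqrXn2 ?ltW ?(hr.1)// (negbTE (hr.2 _ _ _)) // eq_sym.
have XE : (X *m (rdiag r)^T) k k = X k (wide k) * r 0 k.
  rewrite mxE (bigD1 (wide k))//= mxE (rdiagE hdm) eqxx big1 ?addr0// => j /negbTE jk.
  by rewrite mxE (rdiagE hdm) jk mulr0.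
have YE : (rdiag r *m X^T) k k = X k (wide k) * r 0 k.
  by rewrite -XE -[in LHS](trmxK (rdiag r)) -trmx_mul mxE.
by rewrite mxE XE YE -mulr2n mulrn_eq0/= mulf_eq0 (gt_eqF (hr.1 k)) orbF => /eqP.
Qed.

(** The solution of [X = u D + D v^T] with [D = rdiag r] and skew [u], [v]: for
    each pair of indices, a two-by-two system of determinant
    [r_j^2 - r_i^2]. *)
Definition solve_u r X : 'M[R]_d := \matrix_(i, j)
  ((X i (wide j) * r 0 j + X j (wide i) * r 0 i) / (r 0 j ^+ 2 - r 0 i ^+ 2)).

Definition solve_v r X : 'M[R]_m := \matrix_(i, j)
  ((pad X i j * pad (rdiag r) i i + pad X j i * pad (rdiag r) j j)
   / (pad (rdiag r) j j ^+ 2 - pad (rdiag r) i i ^+ 2)).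

Lemma solve_u_skew r X : skew (solve_u r X).
Proof.
apply/matrixP => i j; rewrite !mxE -[in RHS](opprB (r 0 i ^+ 2)) invrN mulrN opprK.
by rewrite addrC.
Qed.

Lemma solve_v_skew r X : skew (solve_v r X).
Proof.
apply/matrixP => i j; rewrite [LHS]mxE [RHS]mxE [solve_v _ _ _ _]mxE [solve_v _ _ i j]mxE.
by rewrite -[in RHS](opprB (pad (rdiag r) i i ^+ 2)) invrN mulrN opprK addrC.
Qed.

(** For [z = r] this recovers [X].  For general [z] it is the derivative, in the
    direction [X] at [D_r], of the normal field that the action carries from [D_z];
    up to sign, the shape operator in the direction [D_z] applied to [X]. *)
Lemma infact_solve r X z i j :
  infact (solve_u r X) (solve_v r X) (rdiag z) i j =
  (X i j * (pad (rdiag r) j j * pad (rdiag z) j j - z 0 i * r 0 i)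
   + pad X j (wide i) * (r 0 i * pad (rdiag z) j j - z 0 i * pad (rdiag r) j j))
  / (pad (rdiag r) j j ^+ 2 - r 0 i ^+ 2).
Proof.
rewrite /infact mxE.
have -> : (rdiag z *m (solve_v r X)^T) i j = z 0 i * solve_v r X j (wide i).
  rewrite mxE (bigD1 (wide i))//= [in X in _ * X]mxE (rdiagE hdm) eqxx mulr1n big1 ?addr0//.
  by move=> l /negbTE li; rewrite (rdiagE hdm) li mul0r.
rewrite [solve_v _ _ _ _]mxE !padE rdiagE eqxx mulr1n.
have -> : (solve_u r X *m rdiag z) i j =
  (X i j * pad (rdiag r) j j + pad X j (wide i) * r 0 i) / (pad (rdiag r) j j ^+ 2 - r 0 i ^+ 2)
    * pad (rdiag z) j j.
  rewrite mxE; case: (wideP hdm j) => [k ->|dj].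
    rewrite (bigD1 k)//= (rdiagE hdm) eqxx mulr1n big1 ?addr0; last first.
      by move=> l lk; rewrite (rdiagE hdm) (inj_eq (@wide_inj _ _ hdm)) eq_sym (negbTE lk) mulr0.
    by rewrite mxE !padE !(rdiagE hdm) !eqxx.
  rewrite (pad_out (rdiag z))// mulr0 big1// => l _.
  rewrite (rdiagE hdm); case: eqP => [jl|]; last by rewrite mulr0.
  by move: dj; rewrite jl /= leqNgt ltn_ord.
by rewrite -(opprB (pad (rdiag r) j j ^+ 2)) invrN; ring.
Qed.

Lemma infact_solveK r X : regular r -> (forall k, X k (wide k) = 0) ->
  infact (solve_u r X) (solve_v r X) (rdiag r) = X.
Proof.
move=> hr X0; apply/matrixP => i j; rewrite infact_solve.
have [->|ji] := eqVneq j (wide i).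
  by rewrite (padE hdm X) X0 !mul0r addr0 mul0r.
have := regular_sqr_neq hr ji; rewrite -oppr_eq0 opprB => D0.
by rewrite [r 0 i * _]mulrC subrr mulr0 addr0 -!expr2 mulfK.
Qed.

End TangentSpace.

Section TangentSpaceAtSVD.
Variables (R : realType) (d m : nat) (hdm : (d <= m)%N).
Variables (P : 'M[R]_d) (Q : 'M[R]_m) (r : 'rV[R]_d).
Hypotheses (hP : orthogonal_group P) (hQ : orthogonal_group Q) (hr : regular r).
Implicit Types (B N X Y Z : 'M[R]_(d, m)) (z : 'rV[R]_d).

Notation wide := (wide hdm).
Let A := biact P Q (rdiag m r).
Let S := orbit_mx A.
Let hat X := biact P^T Q^T X.

Let hatK X : biact P Q (hat X) = X. Proof. exact: biactKV. Qed.
Let Khat X : hat (biact P Q X) = X. Proof. exact: biactK. Qed.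

Lemma skew_conj k (U u : 'M[R]_k) : skew u -> skew (U *m u *m U^T).
Proof. by rewrite /skew => hu; rewrite !trmx_mul trmxK hu mulNmx mulmxN mulmxA. Qed.

Lemma infact_conj u v B :
  infact (P *m u *m P^T) (Q *m v *m Q^T) (biact P Q B) = biact P Q (infact u v B).
Proof.
rewrite /infact /biact !trmx_mul !trmxK mulmxDr mulmxDl !mulmxA; congr (_ + _).
  by rewrite -(mulmxA _ P^T P) orthogonal_trK// mulmx1.
by rewrite -(mulmxA _ Q^T Q) orthogonal_trK// mulmx1.
Qed.

Lemma tangent_spaceP X : tangent_space S A X <-> forall k, hat X k (wide k) = 0.
Proof.
split=> [TX k|X0].
  have SD : S (rdiag m r).
    by rewrite -[rdiag m r]Khat; apply: orbit_biact (orbit_refl _); exact: orthogonal_tr.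
  have := @tangent_rdiagonal R d m hdm A r (hat X) k hr SD. apply.
  by rewrite -[rdiag m r]Khat; apply: tangent_biact TX; exact: orthogonal_tr.
rewrite -[X]hatK -(infact_solveK hr X0) -infact_conj.
apply: infact_tangent; first exact: orbit_refl.
  exact/skew_conj/solve_u_skew.
exact/skew_conj/solve_v_skew.
Qed.

End TangentSpaceAtSVD.

(** * The mean curvature of an orbit *)

(** The gradient, in the singular values, of the logarithm of the volume of the
    orbit; [p] is the number [m - d] of extra columns. *)
Definition log_volume_grad (R : realType) (d p : nat) (r : 'rV[R]_d) : 'rV[R]_d :=
  \row_k (\sum_(j < d | j != k) ((r 0 k - r 0 j)^-1 + (r 0 k + r 0 j)^-1)
          + p%:R / r 0 k).

Lemma sum_wide (R : realType) (d m : nat) (hdm : (d <= m)%N) (F : 'I_m -> R) (c : R) :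
  (forall j : 'I_m, (d <= j)%N -> F j = c) ->
  \sum_j F j = \sum_(i < d) F (wide hdm i) + (m - d)%:R * c.
Proof.
move=> Fc; rewrite (bigID (fun j : 'I_m => (j < d)%N))/=; congr (_ + _).
  by rewrite (big_ord_narrow hdm).
rewrite (eq_bigr (fun=> c)) => [|j]; last by rewrite -leqNgt; exact: Fc.
rewrite sumr_const -[LHS]mulr_natl; congr (_%:R * _).
have cd : #|(fun j : 'I_m => (j < d)%N)| = d.
  by rewrite -sum1_card (big_ord_narrow hdm) sum1_card card_ord.
apply: (@addnI d); rewrite subnKC// -{1}cd -[RHS]card_ord.
exact: (cardC (fun j : 'I_m => (j < d)%N)).
Qed.

Section MeanCurvatureAtSVD.
Variables (R : realType) (d m : nat) (hdm : (d <= m)%N).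
Variables (P : 'M[R]_d) (Q : 'M[R]_m) (r : 'rV[R]_d).
Hypotheses (hP : orthogonal_group P) (hQ : orthogonal_group Q) (hr : regular r).
Implicit Types (B N X Y Z : 'M[R]_(d, m)) (z : 'rV[R]_d).

Notation wide := (wide hdm).
Let A := biact P Q (rdiag m r).
Let S := orbit_mx A.
Let T := tangent_space S A.
Let hat X := biact P^T Q^T X.

Let hatK X : biact P Q (hat X) = X. Proof. exact: biactKV. Qed.
Let Khat X : hat (biact P Q X) = X. Proof. exact: biactK. Qed.
Let TP X : T X <-> forall k, hat X k (wide k) = 0. Proof. exact: tangent_spaceP. Qed.

Lemma tangent_delta k l : l != wide k -> T (biact P Q (delta_mx k l)).
Proof.
move=> lk; apply/TP => i; rewrite Khat mxE; case: eqVneq => //= ->.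
by rewrite eq_sym (negbTE lk).
Qed.

Lemma frobenius_rdiag_tangent X z : T X -> frobenius X (biact P Q (rdiag m z)) = 0.
Proof.
move=> /TP X0; rewrite frobeniusC frobenius_biactl frobeniusC (frobenius_rdiag hdm).
by rewrite big1// => i _; rewrite X0 mul0r.
Qed.

Lemma differentiable_infact u v B : differentiable (@infact R d m u v) B.
Proof.
have cont : continuous (@infact R d m u v).
  move=> C; apply: (cvgD (F := nbhs C)).
    by apply: (cvg_mulmx (F := nbhs C)); [exact: cvg_cst|exact: cvg_id].
  by apply: (cvg_mulmx (F := nbhs C)); [exact: cvg_id|exact: cvg_cst].
have lin : linear (@infact R d m u v).
  move=> a C D; rewrite /infact mulmxDr mulmxDl scalerDr -scalemxAr -scalemxAl.
  by rewrite addrACA.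
pose H := GRing.isLinear.Build R 'M[R]_(d, m) 'M[R]_(d, m) _ (@infact R d m u v) lin.
pose L : {linear _ -> _} := HB.pack (@infact R d m u v) H.
exact: (@linear_differentiable _ _ _ L).
Qed.

(** The linear field [u B + B v^T] extends each of its values to a field tangent
    to the orbit, which shows that the second fundamental form is a genuine
    normal component and not a default value. *)
Lemma second_fundamental_form_tangent X z : T X ->
  frobenius (second_fundamental_form S A X X) (biact P Q (rdiag m z)) =
  - \sum_i \sum_j hat X i j *
      infact (solve_u hdm r (hat X)) (solve_v r (hat X)) (rdiag m z) i j.
Proof.
move=> TX.
set u := solve_u hdm r (hat X); set v := solve_v r (hat X).
have su : skew u by exact: solve_u_skew.
have sv : skew v by exact: solve_v_skew.
pose u' := P *m u *m P^T; pose v' := Q *m v *m Q^T.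
have su' : skew u' by exact: skew_conj.
have sv' : skew v' by exact: skew_conj.
have XE : infact u' v' A = X.
  rewrite infact_conj// infact_solveK//; exact: (TP X).1.
have [N [F [dF FT FA WN]]] : exists N, exists F : 'M[R]_(d, m) -> 'M[R]_(d, m),
    [/\ differentiable F A, \forall B \near A, S B -> tangent_space S B (F B),
        F A = X & normal_component (tangent_space S A) ('D_X F A) N].
  pose D := 'D_X (@infact R d m u' v') A.
  exists (biact P Q (rdiag m (rdiagonal hdm (hat D)))), (@infact R d m u' v'); split=> //.
  - exact: differentiable_infact.
  - by near=> B => SB; exact: infact_tangent.
  - split=> [Z /(frobenius_rdiag_tangent (rdiagonal hdm (hat D)))|].
      by rewrite frobeniusC.
    apply/TP => k; set Nd := rdiag m _.
    have -> : hat (D - biact P Q Nd) = hat D - Nd by rewrite -[in RHS](Khat Nd) /hat biactB.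
    rewrite [LHS]mxE [X in _ + X]mxE.
    by rewrite (rdiagE hdm) eqxx mulr1n [fun_of_matrix (rdiagonal _ _) _ _]mxE subrr.
rewrite /second_fundamental_form; case: xgetP => [N' _ [F' [dF' FT' FA' WN']]|none]; last first.
  by case: (none N); exists F.
rewrite -[X in 'D_X _ _]XE in WN'.
rewrite (second_fundamental_form_pairing su' sv' dF' FT' WN'); last first.
  by move=> Y; exact: frobenius_rdiag_tangent.
rewrite FA' infact_conj// frobeniusC frobenius_biactl frobeniusC frobeniusE.
by [].
Unshelve. all: by end_near. Qed.

(** Expanding an off-diagonal matrix unit in the basis.  By this relation the trace
    of a quadratic form does not depend on the orthonormal basis and can be read off
    from its coefficients in the matrix units. *)
Lemma orthonormal_basis_completeness k (e : 'I_k -> 'M[R]_(d, m)) a b i j :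
  orthonormal_basis T e -> b != wide a ->
  \sum_l hat (e l) a b * hat (e l) i j = ((i == a) && (j == b))%:R.
Proof.
move=> [Te on span] ba; have [c cE] := span _ (tangent_delta ba).
have cl l : c l = hat (e l) a b.
  rewrite -[RHS]frobenius_delta frobenius_biactl !trmxK cE frobeniusC frobenius_suml.
  rewrite (bigD1 l)//= frobeniusZl on eqxx mulr1 big1 ?addr0// => q /negbTE ql.
  by rewrite frobeniusZl on ql mulr0.
have := congr1 (fun M => hat M i j) cE; rewrite Khat mxE => ->.
rewrite /hat biact_sum summxE; apply: eq_bigr => l _.
by rewrite biactZ [RHS]mxE cl.
Qed.

Lemma exists_orthonormal_basis : exists k (e : 'I_k -> 'M[R]_(d, m)), orthonormal_basis T e.
Proof.
pose K := [set p : 'I_d * 'I_m | p.2 != wide p.1]%SET.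
exists #|K|, (fun i => biact P Q (delta_mx (enum_val i).1 (enum_val i).2)); split.
- by move=> i; apply: tangent_delta; have := enum_valP i; rewrite inE.
- move=> i j; rewrite frobenius_biact// frobenius_delta mxE.
  rewrite -(inj_eq enum_val_inj) eq_sym [in RHS]eq_sym.
  case: (enum_val i) => a b; case: (enum_val j) => a' b' /=.
  by rewrite xpair_eqE eq_sym [b' == b]eq_sym.
- move=> X /TP X0; exists (fun i => hat X (enum_val i).1 (enum_val i).2).
  rewrite -[LHS]hatK {1}[hat X]matrix_sum_delta pair_big/= biact_sum.
  rewrite (bigID (mem K))/= [X in _ + X]big1 ?addr0.
    rewrite big_enum_val; apply: eq_bigr => i _; exact: biactZ.
  move=> [a b]; rewrite inE/= negbK => /eqP ->.
  by rewrite X0 scale0r /biact mulmx0 mul0mx.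
Qed.

(** For [z] the unit vector [a], the coefficient of [infact_solve] at the entry
    [(i, j)] is nonzero only if [a] is one of [i], [j]; the two orders of [a] and [j]
    give twice [r_a / (r_a^2 - r_j^2)], and each of the extra columns gives
    [1 / r_a]. *)
Lemma mean_curvature_svd :
  mean_curvature S A = - biact P Q (rdiag m (log_volume_grad (m - d) r)).
Proof.
set h := mean_curvature S A.
have hE : h = biact P Q (rdiag m (rdiagonal hdm (hat h))).
  rewrite -{1}[h]hatK; congr biact; apply/matrixP => i j.
  rewrite (rdiagE hdm) [fun_of_matrix (rdiagonal _ _) _ _]mxE; have [->//|ji] := eqVneq.
  rewrite -[LHS]frobenius_delta frobenius_biactl !trmxK.
  exact: mean_curvature_normal (tangent_delta ji).
have [k [e [ob hsum]]] : exists k (e : 'I_k -> 'M[R]_(d, m)), orthonormal_basis T e /\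
    h = \sum_i second_fundamental_form S A (e i) (e i).
  have [k0 [e0 ob0]] := exists_orthonormal_basis.
  rewrite /h /mean_curvature; case: xgetP => [h' _ [k [e he]]|none]; first by exists k, e.
  by case: (none (\sum_i second_fundamental_form S A (e0 i) (e0 i))); exists k0, e0.
rewrite hE -biactN -rdiagN; congr (biact _ _ (rdiag _ _)); apply/rowP => a.
pose z : 'rV[R]_d := delta_mx 0 a.
have zE i : z 0 i = (i == a)%:R by rewrite mxE eqxx.
have -> : rdiagonal hdm (hat h) 0 a = frobenius h (biact P Q (rdiag m z)).
  rewrite frobeniusC frobenius_biactl frobeniusC (frobenius_rdiag hdm).
  rewrite [LHS]mxE (bigD1 a)//= zE eqxx mulr1 big1 ?addr0// => i /negbTE ia.
  by rewrite zE ia mulr0.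
rewrite hsum frobenius_suml [RHS]mxE.
rewrite (eq_bigr (fun l => - \sum_i \sum_j hat (e l) i j *
      infact (solve_u hdm r (hat (e l))) (solve_v r (hat (e l))) (rdiag m z) i j)); last first.
  by move=> l _; apply: second_fundamental_form_tangent; case: ob.
rewrite sumrN exchange_big/=; congr (- _).
under eq_bigr do rewrite exchange_big/=.
(* In each row the coefficient of the matrix unit on itself survives; the
   coefficient on the transposed unit is lost by completeness. *)
pose rho j := pad (rdiag m r) j j; pose zeta j := pad (rdiag m z) j j.
have coef i j : \sum_l hat (e l) i j *
      infact (solve_u hdm r (hat (e l))) (solve_v r (hat (e l))) (rdiag m z) i j =
    if j == wide i then 0 else
      (rho j * zeta j - z 0 i * r 0 i) / (rho j ^+ 2 - r 0 i ^+ 2).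
  have [->|ji] := eqVneq.
    rewrite big1// => l _.
    have /TP -> : T (e l) by case: ob.
    by rewrite mul0r.
  under eq_bigr do rewrite infact_solve mulrA mulrDr mulrA [X in _ + X]mulrA.
  rewrite -mulr_suml; congr (_ / _); rewrite big_split/= -!mulr_suml.
  rewrite (orthonormal_basis_completeness _ _ ob ji) !eqxx mul1r.
  rewrite [X in _ + X](_ : _ = 0) ?addr0//.
  apply/eqP; rewrite mulf_eq0; apply/orP; left; apply/eqP.
  case: (wideP hdm j) ji => [q ->|dj ji]; last first.
    by rewrite big1// => l _; rewrite pad_out// mulr0.
  rewrite (inj_eq (@wide_inj _ _ hdm)) => qi.
  under eq_bigr do rewrite padE.
  rewrite (orthonormal_basis_completeness _ _ ob) ?(negbTE qi)//.
under eq_bigr do under eq_bigr do rewrite coef.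
pose G i q := if q == i then 0 else z 0 q * r 0 q / (r 0 q ^+ 2 - r 0 i ^+ 2).
have r_neq0 i : r 0 i != 0 by rewrite gt_eqF// hr.1.
have row i : \sum_j (if j == wide i then 0 else
      (rho j * zeta j - z 0 i * r 0 i) / (rho j ^+ 2 - r 0 i ^+ 2)) =
    \sum_q (G i q + G q i) + (m - d)%:R * (z 0 i / r 0 i).
  rewrite (sum_wide (c := z 0 i / r 0 i) hdm) => [|j dj]; last first.
    rewrite ifN; last by apply: contraTneq dj => ->; rewrite /= -ltnNge.
    rewrite /rho !pad_out// mul0r expr0n !sub0r invrN mulrNN.
    by field; exact: r_neq0.
  congr (_ + _); apply: eq_bigr => q _.
  rewrite (inj_eq (@wide_inj _ _ hdm)) /rho /zeta !padE !(rdiagE hdm) !eqxx !mulr1n /G.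
  rewrite [i == q]eq_sym; case: eqVneq => [_|qi]; first by rewrite addr0.
  rewrite -[in RHS](opprB (r 0 q ^+ 2) (r 0 i ^+ 2)) invrN; ring.
under eq_bigr do rewrite row.
rewrite big_split/= -mulr_sumr [log_volume_grad _ _ _ _]mxE; congr (_ + _); last first.
  rewrite (bigD1 a)//= zE eqxx mul1r big1 ?addr0// => i /negbTE ia.
  by rewrite zE ia mul0r.
under eq_bigr do rewrite big_split/=.
rewrite big_split/= [X in _ + X]exchange_big/= -mulr2n.
have -> : \sum_i \sum_q G i q = \sum_(i < d | i != a) r 0 a / (r 0 a ^+ 2 - r 0 i ^+ 2).
  rewrite [RHS]big_mkcond/=; apply: eq_bigr => i _.
  rewrite (bigD1 a)//= big1 ?addr0 => [|q /negbTE qa]; last first.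
    by rewrite /G zE qa !mul0r; case: ifP.
  by rewrite /G zE eqxx mul1r eq_sym; case: eqVneq.
rewrite -sumrMnl; apply: eq_bigr => i ia.
have /hr.2 ria : a != i by rewrite eq_sym.
have ri : r 0 a + r 0 i != 0 by rewrite gt_eqF// addr_gt0// hr.1.
rewrite -subr_eq0 in ria.
rewrite subr_sqr -mulrnAl; field.
by rewrite ria ri.
Qed.

End MeanCurvatureAtSVD.

(** * Local boundedness of the curvature *)

Section Boundedness.
Variables (R : realType) (d m : nat) (hdm : (d <= m)%N).
Implicit Types (B : 'M[R]_(d, m)) (r c : 'rV[R]_d).

Lemma regular_distinct_positive r : distinct_positive r -> regular r.
Proof.
move=> [r0 rd]; split=> // i j; rewrite -(inj_eq val_inj) neq_ltn => /orP[|] /rd ij.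
  by rewrite gt_eqF.
by rewrite lt_eqF.
Qed.

Lemma cvg_log_volume_grad p r k : regular r ->
  (fun c => log_volume_grad p c 0 k) @ nbhs r --> log_volume_grad p r 0 k.
Proof.
move=> [r0 rd]; rewrite mxE; under eq_fun do rewrite mxE.
have cr i : (fun c : 'rV[R]_d => c 0 i) @ nbhs r --> r 0 i by exact: coord_continuous.
apply: (cvgD (F := nbhs r)); last first.
  apply: (cvgM (F := nbhs r)); first exact: cvg_cst.
  by apply: (cvgV (F := nbhs r)) => //; rewrite gt_eqF.
rewrite big_mkcond/=; under eq_fun do rewrite big_mkcond/=.
apply: (cvg_sumr (F := nbhs r)) => i; case: ifP => ik; last exact: cvg_cst.
apply: (cvgD (F := nbhs r)); apply: (cvgV (F := nbhs r)).
- by rewrite subr_eq0 rd// eq_sym.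
- exact: (cvgB (F := nbhs r)).
- by rewrite gt_eqF// addr_gt0.
- exact: (cvgD (F := nbhs r)).
Qed.

Lemma near_regular r : regular r -> \forall c \near r, regular c.
Proof.
move=> [r0 rd].
have cr i : (fun c : 'rV[R]_d => c 0 i) @ nbhs r --> r 0 i by exact: coord_continuous.
have pos : \forall c \near r, forall i, 0 < (c : 'rV[R]_d) 0 i.
  by apply: (@filter_forall _ _ (fun i c => 0 < (c : 'rV[R]_d) 0 i) (nbhs r)) => i; exact: (cvgr_gt _ (cr i) _ (r0 i)).
have neq : \forall c \near r, forall q : 'I_d * 'I_d, q.1 != q.2 -> (c : 'rV[R]_d) 0 q.1 != c 0 q.2.
  apply: (@filter_forall _ _ (fun (q : 'I_d * 'I_d) c =>
    q.1 != q.2 -> (c : 'rV[R]_d) 0 q.1 != c 0 q.2) (nbhs r)) => -[i j] /=; have [->|ij] := eqVneq i j.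
    by apply: nearW.
  have rij : r 0 i - r 0 j != 0 by rewrite subr_eq0 rd.
  have cij : (fun c : 'rV[R]_d => c 0 i - c 0 j) @ nbhs r --> r 0 i - r 0 j.
    exact: cvgB (cr i) (cr j).
  apply: (@filterS _ (nbhs r) _ _ _ _ (cvgr_neq0 _ cij rij)) => c cn _.
  by rewrite -subr_eq0.
by apply: filterS2 pos neq => c c0 cn; split=> // i j; exact: (cn (i, j)).
Qed.

End Boundedness.

(** * Functions on an interval *)

Section RealFunctions.
Variable R : realType.
Implicit Types (f g : R -> R) (a b t x : R).

Lemma left_limit_le f t a : 0 < t -> f @ t --> f t ->
  (forall s, 0 <= s < t -> f s <= a) -> f t <= a.
Proof.
move=> t0 ft fa; rewrite leNgt; apply/negP => aft.
have [e /= e0 he] := cvgr_gt _ ft _ aft.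
pose s := Num.max 0 (t - e / 2).
have st : s < t by rewrite /s gt_max t0/=; lra.
have s0 : 0 <= s by rewrite le_max lexx.
have := fa s; rewrite s0 st => /(_ isT); rewrite leNgt he//= /ball_/= gtr0_norm ?subr_gt0//.
have : t - e / 2 <= s by rewrite le_max lexx orbT.
by lra.
Qed.

Lemma sqr_sum_le (I : finType) (f : I -> R) :
  (\sum_i f i) ^+ 2 <= #|I|%:R * \sum_i f i ^+ 2.
Proof.
have sumE : \sum_i \sum_(j : I) f i ^+ 2 = #|I|%:R * \sum_i f i ^+ 2.
  by rewrite mulr_sumr; apply: eq_bigr => i _; rewrite sumr_const mulr_natl.
rewrite -[leRHS]sumE.
have -> : \sum_i \sum_(j : I) f i ^+ 2 = \sum_i \sum_j (f i ^+ 2 + f j ^+ 2) / 2.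
  apply/esym; under eq_bigr do rewrite -mulr_suml big_split/=.
  by rewrite -mulr_suml big_split/= [X in _ + X]exchange_big/=; lra.
rewrite expr2 mulr_suml; apply: ler_sum => i _; rewrite mulr_sumr; apply: ler_sum => j _.
by have := sqr_ge0 (f i - f j); lra.
Qed.

(** The function [f e^(- C t)] decreases from [0]. *)
Lemma gronwall_le0 f (df : R -> R) a b C : f a = 0 ->
  (forall x, f @ x --> f x) ->
  (forall x, a < x < b -> is_derive x 1 f (df x)) ->
  (forall x, a < x < b -> df x <= C * f x) ->
  forall x, a <= x <= b -> f x <= 0.
Proof.
move=> fa cf dfx dfC x /andP[ax xb].
pose E t := expR (- C * t); pose h t := f t * E t.
have dE t : is_derive t 1 E (- C * E t).
  have dlin : is_derive t 1 (fun t => - C * t) (- C).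
    apply: is_derive_eq (is_derive_mulr (is_derive_cst (- C) t 1) (is_derive_id t 1)) _.
    by rewrite mul0r add0r mulr1.
  by apply: is_derive_eq (is_derive1_comp (f := expR) (is_derive_expR _) dlin) _; rewrite mulrC.
have dh t : a < t < b -> is_derive t 1 h (df t * E t + f t * (- C * E t)).
  by move=> /dfx dft; exact: is_derive_mulr.
have ch : {within `[a, b], continuous h}.
  apply: continuous_subspaceT => t; apply: cvgM; first exact: cf.
  by case: (dE t) => /derivable1_diffP/differentiable_continuous.
have : h x <= h a.
  apply: (@ler0_derive1_le_cc _ h a b) => //; rewrite ?in_itv/= ?lexx ?ax//.
  - by move=> t; rewrite in_itv/= => /dh[].
  - move=> t; rewrite in_itv/= derive1E => tab; have [_ ->] := dh t tab.
    have -> : df t * E t + f t * (- C * E t) = (df t - C * f t) * E t by ring.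
    by rewrite pmulr_lle0 ?expR_gt0// subr_le0 dfC.
  - by rewrite (le_trans ax).
by rewrite /h fa mul0r pmulr_lle0 ?expR_gt0.
Qed.

(** The logarithmic derivative, written without a quotient so that the rule for
    products holds without conditions on the sign or the zeros of [f]. *)
Definition logder f x a := is_derive x 1 f (f x * a).

Lemma logder_ratio f x (f' : R) : f x != 0 -> is_derive x 1 f f' -> logder f x (f' / f x).
Proof. by move=> fx df; rewrite /logder mulrC divfK. Qed.

Lemma logderM f g x a b : logder f x a -> logder g x b ->
  logder (fun t => f t * g t) x (a + b).
Proof. by move=> df dg; apply: is_derive_eq (is_derive_mulr df dg) _; ring. Qed.

Lemma logder_prod (I : Type) (s : seq I) (P : pred I) (f : I -> R -> R) x (a : I -> R) :
  (forall i, P i -> logder (f i) x (a i)) ->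
  logder (fun t => \prod_(i <- s | P i) f i t) x (\sum_(i <- s | P i) a i).
Proof.
move=> fa; elim: s => [|i s IH].
  rewrite big_nil /logder mulr0; under eq_fun do rewrite big_nil; exact: is_derive_cst.
rewrite big_cons; under eq_fun do rewrite big_cons.
by case: ifP => // /fa fi; exact: logderM.
Qed.

Lemma logderX f x a n : logder f x a -> logder (fun t => f t ^+ n) x (n%:R * a).
Proof.
move=> fa; elim: n => [|n IH].
  by rewrite /logder mul0r mulr0; exact: is_derive_cst.
under eq_fun do rewrite exprS.
by rewrite -nat1r mulrDl mul1r; exact: logderM.
Qed.

End RealFunctions.

Section CurvatureBound.
Variables (R : realType) (d m : nat) (hdm : (d <= m)%N).
Implicit Types (B : 'M[R]_(d, m)) (r c : 'rV[R]_d).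

(** The nearest diagonal point supplies a singular value decomposition of [B]
    whose singular values are close to [r], hence as well separated; the
    curvature formula then bounds the curvature at [B]. *)
Lemma mean_curvature_bounded r : regular r -> exists e K : R, 0 < e /\
  forall (P : 'M[R]_d) (Q : 'M[R]_m) B, orthogonal_group P -> orthogonal_group Q ->
    frobenius (B - rdiag m r) (B - rdiag m r) < e ->
    forall i j, `|biact P^T Q^T (mean_curvature (orbit_mx (biact P Q B)) (biact P Q B)) i j| <= K.
Proof.
move=> hr; pose g c := log_volume_grad (m - d) c.
pose G c := \sum_k g c 0 k ^+ 2.
have cG : G @ nbhs r --> G r.
  apply: (cvg_sumr (F := nbhs r)) => k; rewrite expr2; under eq_fun do rewrite expr2.
  by apply: (cvgM (F := nbhs r)); exact: cvg_log_volume_grad.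
have GK : \forall c \near r, G c < G r + 1.
  by apply: (cvgr_lt _ cG); lra.
have near_r : \forall c \near r, regular c /\ G c < G r + 1.
  by apply: (@filterS2 _ (nbhs r) _ _ _ _ _ (near_regular hr) GK) => c.
have [e /= e0 he] := (nbhs_ballP _ _).1 near_r.
(* an entry has square less than [G r + 1], which is at most [(G r + 2) ^ 2] *)
exists (e ^+ 2), (G r + 2); split; first by rewrite exprn_gt0.
move=> P Q B hP hQ Be i j.
have [U [V [c [hU hV Bc cr]]]] := nearest_rdiag hdm B hr.
have [hc Gc] : regular c /\ G c < G r + 1.
  apply: he; split=> // a b; rewrite (ord1 a) /ball/=.
  have := frobenius_sqr_ge (rdiag m c - rdiag m r) b (wide hdm b).
  rewrite -rdiagB (rdiagE hdm) eqxx mulr1n => h.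
  have : (c - r) 0 b ^+ 2 < e ^+ 2.
    by apply: le_lt_trans h _; rewrite rdiagB; exact: le_lt_trans cr Be.
  by rewrite !mxE -(ltr_sqr (normr_ge0 _)) ?nnegrE ?ltW// distrC real_normK ?num_real.
have BE : biact P Q B = biact (P *m U^T) (Q *m V^T) (rdiag m c).
  by rewrite -Bc -biactM biactK.
have hPU : orthogonal_group (P *m U^T) by exact/orthogonalM/orthogonal_tr.
have hQV : orthogonal_group (Q *m V^T) by exact/orthogonalM/orthogonal_tr.
rewrite BE (mean_curvature_svd hdm hPU hQV hc).
set N := biact _ _ (- _).
have NG : frobenius N N = G c.
  rewrite /N frobenius_biact//; try exact: orthogonal_tr.
  rewrite frobeniusNl frobeniusC frobeniusNl opprK frobenius_biact//.
  rewrite (frobenius_rdiag hdm); apply: eq_bigr => k _.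
  by rewrite (rdiagE hdm) eqxx mulr1n -expr2.
have := frobenius_sqr_ge N i j; rewrite NG => hN.
have {hN} : `|N i j| ^+ 2 < G r + 1 by rewrite real_normK ?num_real//; exact: le_lt_trans hN Gc.
have : 0 <= G r by apply: sumr_ge0 => k _; exact: sqr_ge0.
by have := normr_ge0 (N i j); nra.
Qed.

End CurvatureBound.

(** * Flow lines stay diagonal and regular *)

(** A curve [B] of rectangular matrices with velocity [N].  It is used for
    [B = P^T A Q], extended to negative times by its initial value. *)
Section Flow.
Variables (R : realType) (d m : nat) (hdm : (d <= m)%N).
Variables (B N : R -> 'M[R]_(d, m)).
Hypothesis cB : forall t, B @ t --> B t.
Hypothesis dB : forall t : R, 0 < t -> is_derive t (1 : R) B (N t).
Hypothesis N_sym : forall t : R, 0 < t ->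
  (N t *m (B t)^T)^T = N t *m (B t)^T /\ ((B t)^T *m N t)^T = (B t)^T *m N t.
Hypothesis N_bound : forall r, regular r -> exists e K : R, 0 < e /\
  forall t : R, 0 < t -> frobenius (B t - rdiag m r) (B t - rdiag m r) < e ->
    forall i j, `|N t i j| <= K.

Lemma cvg_entry (t : R) i j : (fun s => B s i j) @ t --> B t i j.
Proof. exact: ((cvg_mxP (F := nbhs t) B (B t)).1 (@cB t)). Qed.

Let C t := pad (B t).
Let O t := offdiag (C t).

Lemma cvg_pad (t : R) i j : (fun s => C s i j) @ t --> C t i j.
Proof.
case: (wideP hdm i) => [k ->|di].
  by rewrite /C padE; under eq_fun do rewrite padE; exact: cvg_entry.
by rewrite /C pad_out//; under eq_fun do rewrite pad_out//; exact: cvg_cst.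
Qed.

Lemma is_derive_pad (t : R) i j : 0 < t -> is_derive t (1 : R) (fun s => C s i j : R) (pad (N t) i j).
Proof.
move=> /dB /is_derive_mxP dBt; case: (wideP hdm i) => [k ->|di].
  by rewrite padE; under eq_fun do rewrite /C padE; exact: dBt.
rewrite pad_out//; under eq_fun do rewrite /C pad_out//; exact: is_derive_cst.
Qed.

Let W t := \sum_i \sum_j `|O t i j|.

(** Near a regular diagonal matrix the off-diagonal velocity is bounded by the
    off-diagonal part of the point itself, by [symmetric_pair_entry] and the
    local bound on the velocity. *)
Lemma offdiag_velocity_bound (T : R) r : 0 <= T -> regular r -> B T = rdiag m r ->
  exists e L : R, 0 < e /\ forall s : R, T < s < T + e ->
    forall i j, i != j -> `|pad (N s) i j| <= L * W s.
Proof.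
move=> T0 hr BT; have [e0 [K1 [e0_gt0 NK1]]] := N_bound hr.
pose K := `|K1|; have K0 : 0 <= K by exact: normr_ge0.
have NK s : 0 < s -> frobenius (B s - rdiag m r) (B s - rdiag m r) < e0 ->
    forall i j, `|N s i j| <= K.
  by move=> s0 Bs i j; exact: le_trans (NK1 s s0 Bs i j) (ler_norm _).
have CT : C T = pad (rdiag m r) by rewrite /C BT.
pose gap s i j := C s (wide hdm i) (wide hdm i) ^+ 2 - C s j j ^+ 2.
have cgap i j : (fun s => gap s i j) @ T --> gap T i j.
  apply: (cvgB (F := nbhs T)); rewrite expr2; under eq_fun do rewrite expr2;
  by apply: (cvgM (F := nbhs T)); exact: cvg_pad.
have gap0 i j : j != wide hdm i -> gap T i j != 0.
  move=> ji; rewrite /gap CT padE (rdiagE hdm) eqxx mulr1n.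
  exact: regular_sqr_neq.
(* sums serve as common bounds for finitely many quantities; adding 1 leaves room
   for their variation near [T] *)
pose M := \sum_i \sum_j `|(gap T i j)^-1| + 1.
pose D := \sum_i `|C T i i| + 1.
have n1 : \forall s \near T, frobenius (B s - rdiag m r) (B s - rdiag m r) < e0.
  have cf : (fun s => frobenius (B s - rdiag m r) (B s - rdiag m r)) @ T --> (0 : R).
    have -> : (0 : R) = frobenius (B T - rdiag m r) (B T - rdiag m r).
      by rewrite BT subrr frobenius0l.
    have cBr : (fun s => B s - rdiag m r) @ nbhs T --> B T - rdiag m r.
      by apply: (cvgB (F := nbhs T)); [exact: cB|exact: cvg_cst].
    exact: (cvg_frobenius (F := nbhs T)).
  exact: (cvgr_lt _ cf).
have n2 : \forall s \near T, forall i, `|C s i i| <= D.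
  apply: (@filter_forall _ _ (fun i s => `|C s i i| <= D) (nbhs T)) => i.
  have CD : `|C T i i| < D.
    by rewrite /D (bigD1 i)//= -addrA ltrDl ltr_wpDl// sumr_ge0.
  exact: (cvgr_le _ (cvg_norm (@cvg_pad T i i)) _ CD).
have n3 : \forall s \near T, forall q : 'I_d * 'I_m, q.2 != wide hdm q.1 ->
    gap s q.1 q.2 != 0 /\ `|(gap s q.1 q.2)^-1| <= M.
  apply: (@filter_forall _ _ (fun (q : 'I_d * 'I_m) s => q.2 != wide hdm q.1 ->
    gap s q.1 q.2 != 0 /\ `|(gap s q.1 q.2)^-1| <= M) (nbhs T)) => -[a b] /=.
  have [->|ba] := eqVneq b (wide hdm a); first by apply: nearW.
  have cVgap : (fun s => `|(gap s a b)^-1|) @ nbhs T --> `|(gap T a b)^-1|.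
    by apply: cvg_norm; apply: (cvgV (F := nbhs T)); [exact: gap0|exact: cgap].
  have VM : `|(gap T a b)^-1| < M.
    rewrite /M (bigD1 a)//= (bigD1 b)//= -!addrA ltrDl.
    rewrite ltr_wpDl ?sumr_ge0// ltr_wpDl// sumr_ge0// => q _; exact: sumr_ge0.
  have n30 : \forall s \near T, gap s a b != 0.
    exact: (cvgr_neq0 _ (@cgap a b) (gap0 _ _ ba)).
  have n3M : \forall s \near T, `|(gap s a b)^-1| <= M by exact: (cvgr_le _ cVgap _ VM).
  apply: (@filterS2 _ (nbhs T) _ _ _ _ _ n30 n3M).
  by move=> s g0 gM _; split.
have /(nbhs_ballP _ _)[e /= e_gt0 he] : \forall s \near T,
    [/\ frobenius (B s - rdiag m r) (B s - rdiag m r) < e0,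
     forall i, `|C s i i| <= D &
     forall q : 'I_d * 'I_m, q.2 != wide hdm q.1 ->
       gap s q.1 q.2 != 0 /\ `|(gap s q.1 q.2)^-1| <= M].
  by apply: (@filterS3 _ (nbhs T) _ _ _ _ _ _ n1 n2 n3) => s; split.
exists e, (D * (K * 4) * M); split=> // s /andP[Ts se] i j ij.
have [|Bs Cs gaps] := he s; first by rewrite /ball/= ltr_norml; lra.
have s0 : 0 < s by exact: le_lt_trans Ts.
have NsK := NK s s0 Bs.
have [p1 p2] := N_sym s0; have [{}p1 {}p2] := pad_symmetric_pair hdm p1 p2.
have W0 : 0 <= W s by apply: sumr_ge0 => a _; apply: sumr_ge0.
have D0 : 0 <= D by exact: le_trans (Cs i).
case: (wideP hdm i) ij => [a ->|di ij]; last first.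
  rewrite pad_out// normr0.
  have M0 : 0 <= M by apply: addr_ge0 => //; apply: sumr_ge0 => ? _; apply: sumr_ge0.
  by rewrite !mulr_ge0.
rewrite eq_sym => ij.
have [g0 gM] := gaps (a, j) ij.
have entry x y : `|pad (N s) x y| <= K.
  by case: (wideP hdm x) => [b ->|dx]; rewrite ?padE// pad_out// normr0.
have Wrow x : \sum_q `|O s x q| <= W s.
  by rewrite /W [leRHS](bigD1 x)//= lerDl sumr_ge0// => q _; exact: sumr_ge0.
have Wcol y : \sum_q `|O s q y| <= W s.
  by rewrite /W [leRHS]exchange_big/= [leRHS](bigD1 y)//= lerDl sumr_ge0// => q _; exact: sumr_ge0.
have NO x y : `|(pad (N s) *m (O s)^T) x y| <= K * W s.
  rewrite mxE; apply: le_trans (ler_norm_sum _ _ _) (le_trans _ (ler_wpM2l K0 (Wrow y))).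
  rewrite mulr_sumr; apply: ler_sum => q _.
  by rewrite normrM [(O s)^T _ _]mxE ler_wpM2r.
have ON x y : `|((O s)^T *m pad (N s)) x y| <= K * W s.
  rewrite mxE; apply: le_trans (ler_norm_sum _ _ _) (le_trans _ (ler_wpM2l K0 (Wcol x))).
  rewrite mulr_sumr; apply: ler_sum => q _.
  by rewrite normrM [(O s)^T _ _]mxE mulrC ler_wpM2r.
have := symmetric_pair_entry (wide hdm a) j p1 p2; rewrite -/(C s) -/(O s) -/(gap s a j) => e1.
have -> : pad (N s) (wide hdm a) j = (pad (N s) (wide hdm a) j * gap s a j) * (gap s a j)^-1.
  by rewrite mulfK.
rewrite e1 normrM.
have half c x y : `|c| <= D -> `|x| <= K * W s -> `|y| <= K * W s ->
    `|c * (x - y)| <= D * (K * W s * 2).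
  move=> cD xK yK; rewrite normrM; apply: ler_pM => //.
  by apply: le_trans (ler_normB _ _) _; lra.
have -> : D * (K * 4) * M * W s = (D * (K * W s * 2) + D * (K * W s * 2)) * M by ring.
apply: ler_pM => //; apply: le_trans (ler_normB _ _) _.
by apply: lerD; apply: half.
Qed.

(** The off-diagonal part has squared norm [E] with [E' <= C E] to the right of
    [T], so it stays zero. *)
Lemma diagonal_persists (T : R) r : 0 <= T -> regular r -> B T = rdiag m r ->
  exists e : R, 0 < e /\ forall s : R, T <= s < T + e -> B s = rdiag m (rdiagonal hdm (B s)).
Proof.
move=> T0 hr BT; have [e [L [e0 hL]]] := offdiag_velocity_bound T0 hr BT.
pose E (s : R) := \sum_(q : 'I_m * 'I_m) O s q.1 q.2 ^+ 2.
pose dE (s : R) := \sum_(q : 'I_m * 'I_m) offdiag (pad (N s)) q.1 q.2 * O s q.1 q.2 *+ 2.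
have cO (s : R) i j : (fun s => O s i j) @ s --> O s i j.
  rewrite /O mxE; under eq_fun do rewrite mxE.
  by case: eqVneq => _; [exact: cvg_cst|exact: cvg_pad].
have dO (s : R) i j : 0 < s -> is_derive s (1 : R) (fun s => O s i j : R) (offdiag (pad (N s)) i j).
  move=> s0; rewrite mxE; under eq_fun do rewrite /O mxE.
  by case: eqVneq => _; [exact: is_derive_cst|exact: is_derive_pad].
have cE (s : R) : E @ s --> E s.
  apply: (cvg_sumr (F := nbhs s)) => q; rewrite expr2; under eq_fun do rewrite expr2.
  by apply: (cvgM (F := nbhs s)); exact: cO.
have dEs (s : R) : 0 < s -> is_derive s (1 : R) E (dE s).
  move=> s0; apply: is_derive_sumr => q _; under eq_fun do rewrite expr2.
  apply: is_derive_eq (is_derive_mulr (dO s q.1 q.2 s0) (dO s q.1 q.2 s0)) _.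
  by rewrite [X in _ + X]mulrC mulr2n.
have E0 (s : R) : 0 <= E s by apply: sumr_ge0 => q _; exact: sqr_ge0.
have ET : E T = 0.
  have OT : O T = 0 by rewrite /O /C BT offdiag_pad_rdiag.
  by rewrite /E OT big1// => q _; rewrite mxE expr0n.
pose L' := `|L|; pose c := L' * 2 * #|{: 'I_m * 'I_m}|%:R.
have WE s : W s = \sum_(q : 'I_m * 'I_m) `|O s q.1 q.2| by rewrite /W pair_big.
have EW (s : R) : (W s) ^+ 2 <= #|{: 'I_m * 'I_m}|%:R * E s.
  rewrite WE; apply: le_trans (sqr_sum_le _) _; rewrite ler_wpM2l//.
  by apply: ler_sum => q _; rewrite real_normK ?num_real.
have dEle (s : R) : T < s < T + e -> dE s <= c * E s.
  move=> Ts; have W0 : 0 <= W s by apply: sumr_ge0 => a _; apply: sumr_ge0.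
  have step : dE s <= L' * 2 * W s ^+ 2.
    have -> : L' * 2 * W s ^+ 2 = \sum_(q : 'I_m * 'I_m) (L' * W s * `|O s q.1 q.2|) *+ 2.
      by rewrite sumrMnl -mulr_sumr -WE; ring.
    apply: ler_sum => q _; rewrite lerMn2r/=; apply: le_trans (ler_norm _) _.
    rewrite normrM ler_wpM2r// mxE; case: eqVneq => [_|ij].
      by rewrite normr0 mulr_ge0// normr_ge0.
    by apply: le_trans (hL s Ts _ _ ij) _; rewrite ler_wpM2r// ler_norm.
  apply: le_trans step _; rewrite /c -[leRHS]mulrA.
  by apply: ler_wpM2l (EW s); rewrite mulr_ge0 ?normr_ge0.
exists e; split=> // s /andP[Ts se].
have Es : E s <= 0.
  apply: (gronwall_le0 (a := T) (b := s) (C := c) (df := dE)) => //.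
  - by move=> x /andP[Tx _]; apply: dEs; exact: le_lt_trans Tx.
  - by move=> x /andP[Tx xs]; apply: dEle; rewrite Tx (lt_trans xs).
  - by rewrite Ts lexx.
have Eq : E s = 0 by apply: le_anti; rewrite Es E0.
apply/matrixP => i j; rewrite (rdiagE hdm) [fun_of_matrix (rdiagonal _ _) _ _]mxE.
have [->//|ji] := eqVneq.
have /psumr_eq0P/(_ (wide hdm i, j) isT) : E s = 0 by [].
move=> /(_ (fun _ _ => sqr_ge0 _))/eqP; rewrite sqrf_eq0/= => /eqP.
by rewrite mxE eq_sym (negbTE ji) /C padE.
Qed.

Hypothesis hp : (d < m)%N.
Hypothesis N_grad : forall (t : R) r, 0 < t -> regular r -> B t = rdiag m r ->
  N t = rdiag m (log_volume_grad (m - d) r).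

Let good (t : R) := distinct_positive (rdiagonal hdm (B t)) /\ B t = rdiag m (rdiagonal hdm (B t)).
Let r (t : R) k := B t k (wide hdm k).

Let p := (m - d)%N.
(** The fourth power of the volume of the orbit, up to a constant.  The product is
    over ordered pairs, which avoids any use of the order of the indices, and is
    squared because its sign depends on [d]. *)
Definition sqr_volume (t : R) := (\prod_i (\prod_(j < d | j != i) (r t i ^+ 2 - r t j ^+ 2))
   * \prod_i r t i ^+ (2 * p)) ^+ 2.

Lemma cvg_sqr_volume (t : R) : sqr_volume @ t --> sqr_volume t.
Proof.
have cr i : (fun s => r s i) @ t --> r t i by exact: cvg_entry.
have cX (f : R -> R) n : f @ t --> f t -> (fun s => f s ^+ n) @ t --> f t ^+ n.
  move=> cf; elim: n => [|n IH].
    by rewrite expr0; under eq_fun do rewrite expr0; exact: cvg_cst.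
  by rewrite exprS; under eq_fun do rewrite exprS; apply: (cvgM (F := nbhs t)).
apply: (@cX _ 2); apply: (cvgM (F := nbhs t)); apply: (cvg_prodr (F := nbhs t)) => i.
  apply: (cvg_prodr (F := nbhs t)) => j.
  by apply: (cvgB (F := nbhs t)); exact: cX.
exact: cX.
Qed.

(** The velocity is the gradient of the logarithm of the volume, so that this
    logarithm increases at the rate of the squared norm of the gradient. *)
Lemma derive_sqr_volume (t : R) : 0 < t -> good t ->
  exists D, 0 <= D /\ is_derive t (1 : R) sqr_volume D.
Proof.
move=> t0 [dp Bt]; have hr := regular_distinct_positive dp.
have Nt := N_grad t0 hr Bt.
pose g i := log_volume_grad p (rdiagonal hdm (B t)) 0 i.
have rE i : rdiagonal hdm (B t) 0 i = r t i by rewrite mxE.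
have r0 i : r t i != 0 by rewrite -rE gt_eqF// hr.1.
have rB i j : j != i -> r t i ^+ 2 - r t j ^+ 2 != 0.
  move=> ji; rewrite -!rE subr_eq0 eqrXn2 ?ltW ?hr.1//.
  by apply: hr.2; rewrite eq_sym.
have dr i : is_derive t (1 : R) (fun s => r s i : R) (g i).
  have /is_derive_mxP/(_ i (wide hdm i)) := dB t0.
  by rewrite Nt (rdiagE hdm) eqxx.
have dr2 i : is_derive t (1 : R) (fun s => r s i ^+ 2 : R) (r t i * g i *+ 2).
  under eq_fun do rewrite expr2.
  by apply: is_derive_eq (is_derive_mulr (dr i) (dr i)) _; rewrite mulrC mulr2n.
have l1 i j : j != i -> logder (fun s => r s i ^+ 2 - r s j ^+ 2) t
    ((r t i * g i *+ 2 - r t j * g j *+ 2) / (r t i ^+ 2 - r t j ^+ 2)).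
  by move=> ji; apply: logder_ratio; exact: rB.
have l2 i : logder (fun s => r s i ^+ (2 * p)) t ((2 * p)%:R * (g i / r t i)).
  by apply: logderX; exact: logder_ratio.
have lV : logder sqr_volume t (2%:R * (\sum_i \sum_(j < d | j != i)
      ((r t i * g i *+ 2 - r t j * g j *+ 2) / (r t i ^+ 2 - r t j ^+ 2))
    + \sum_i (2 * p)%:R * (g i / r t i))).
  apply: logderX; apply: logderM; apply: logder_prod => i _ //.
  by apply: logder_prod => j; exact: l1.
eexists; split; last exact: lV.
rewrite mulr_ge0 ?sqr_ge0// mulr_ge0//.
have gE i : g i = \sum_(j < d | j != i) (r t i *+ 2 / (r t i ^+ 2 - r t j ^+ 2)) + p%:R / r t i.
  rewrite /g mxE !rE; congr (_ + _); apply: eq_bigr => j ji; rewrite !rE.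
  have := rB i j ji; rewrite subr_sqr mulf_eq0 negb_or => /andP[m0 p0].
  by field; rewrite m0 p0.
suff -> : \sum_i \sum_(j < d | j != i)
      ((r t i * g i *+ 2 - r t j * g j *+ 2) / (r t i ^+ 2 - r t j ^+ 2))
    + \sum_i (2 * p)%:R * (g i / r t i) = (\sum_i g i ^+ 2) *+ 2.
  by rewrite mulrn_wge0// sumr_ge0// => i _; exact: sqr_ge0.
pose H i j := if j == i then 0 else g i * (r t i *+ 2 / (r t i ^+ 2 - r t j ^+ 2)).
have -> : \sum_i \sum_(j < d | j != i)
      ((r t i * g i *+ 2 - r t j * g j *+ 2) / (r t i ^+ 2 - r t j ^+ 2))
    = \sum_i \sum_j H i j + \sum_i \sum_j H j i.
  rewrite -big_split/=; apply: eq_bigr => i _; rewrite -big_split/= big_mkcond/=.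
  apply: eq_bigr => j _; rewrite /H [i == j]eq_sym; case: eqVneq => [_|ji] /=.
    by rewrite addr0.
  rewrite -[in X in _ = _ + X](opprB (r t i ^+ 2)) invrN; ring.
rewrite [X in _ + X + _]exchange_big/= -mulr2n -sumrMnl -big_split/= -sumrMnl.
apply: eq_bigr => i _; rewrite expr2 {3}gE mulrDr mulrnDl; congr (_ + _).
  rewrite mulr_sumr [in RHS]big_mkcond/=; congr (_ *+ 2); apply: eq_bigr => j _.
  by rewrite /H; case: eqVneq.
by rewrite natrM; ring.
Qed.

(** The volume of the orbit has not decreased from its positive initial value, so
    by continuity no two singular values have met and none has vanished. *)
Lemma good_closed (t : R) : 0 < t -> (forall s : R, 0 <= s < t -> good s) -> good t.
Proof.
move=> t0 gs.
have left_le (f : R -> R) a : f @ t --> f t -> (forall s : R, 0 <= s < t -> f s <= a) -> f t <= a.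
  exact: left_limit_le.
have left_eq0 (f : R -> R) : f @ t --> f t -> (forall s : R, 0 <= s < t -> f s = 0) -> f t = 0.
  move=> cf f0; apply: le_anti; apply/andP; split.
    by apply: left_le => // s st; rewrite f0.
  rewrite -oppr_le0; apply: (left_le (fun s => - f s)); first exact: cvgN.
  by move=> s st; rewrite f0// oppr0.
have Bt : B t = rdiag m (rdiagonal hdm (B t)).
  apply/matrixP => i j; rewrite (rdiagE hdm) [fun_of_matrix (rdiagonal _ _) _ _]mxE.
  have [->//|ji] := eqVneq.
  apply: (left_eq0 (fun s => B s i j)); first exact: cvg_entry.
  by move=> s st; have [_ ->] := gs s st; rewrite (rdiagE hdm) (negbTE ji).
have V0 : 0 < sqr_volume 0.
  have [dp _] := gs 0 (introT andP (conj (lexx 0) t0)).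
  have hr := regular_distinct_positive dp.
  have rE i : r 0 i = rdiagonal hdm (B 0) 0 i by rewrite mxE.
  rewrite /sqr_volume exprn_even_gt0//= mulf_neq0//; apply/prodf_neq0 => i _; last first.
    by rewrite expf_neq0// rE gt_eqF// hr.1.
  apply/prodf_neq0 => j ji; rewrite !rE subr_eq0 eqrXn2 ?ltW ?hr.1//.
  by apply: hr.2; rewrite eq_sym.
have Vt : sqr_volume 0 <= sqr_volume t.
  have gst s : s \in `]0, t[ -> exists D, 0 <= D /\ is_derive s (1 : R) sqr_volume D.
    rewrite in_itv/= => /andP[s0 st]; apply: derive_sqr_volume => //.
    by apply: gs; rewrite ltW.
  apply: (@ger0_derive1_le_cc R sqr_volume 0 t); rewrite ?in_itv/= ?lexx ?ltW//.
  - by move=> s /gst[D [_ []]].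
  - by move=> s /gst[D [D0 [_ DE]]]; rewrite derive1E DE.
  - by apply: continuous_subspaceT => s; exact: cvg_sqr_volume.
have /lt0r_neq0 : 0 < sqr_volume t by exact: lt_le_trans Vt.
rewrite expf_eq0/= mulf_eq0 negb_or => /andP[/prodf_neq0 rd /prodf_neq0 rn].
have rge0 i : 0 <= r t i.
  rewrite -oppr_le0; apply: (left_le (fun s => - r s i)); first by apply: (cvgN (F := nbhs t)); exact: cvg_entry.
  move=> s st; have [[/(_ i) + _] _] := gs s st.
  by rewrite mxE oppr_le0 => /ltW.
have rgt0 i : 0 < r t i.
  rewrite lt_def rge0 andbT; apply: contraNneq (rn i isT) => ->.
  by rewrite expr0n muln_eq0/= /p subn_eq0 leqNgt hp.
split=> //; split=> [i|i j ij]; rewrite !mxE; first exact: rgt0.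
rewrite lt_def; apply/andP; split.
  have /prodf_neq0/(_ j) := rd i isT; rewrite -val_eqE/= gtn_eqF// => /(_ isT).
  by apply: contraNneq => e; rewrite /r e subrr.
rewrite -subr_le0; apply: (left_le (fun s => r s j - r s i)).
  by apply: (cvgB (F := nbhs t)); exact: cvg_entry.
move=> s st; have [[_ /(_ i j ij)]] := gs s st.
by rewrite !mxE subr_le0 => /ltW.
Qed.

(** Diagonality persists by [diagonal_persists]; the strict inequalities between the
    singular values persist by continuity. *)
Lemma good_open (T : R) : 0 <= T -> good T ->
  exists e : R, 0 < e /\ forall s, T <= s <= T + e -> good s.
Proof.
move=> T0 [dp BT]; have hr := regular_distinct_positive dp.
have [e1 [e1_gt0 diag]] := diagonal_persists T0 hr BT.
have cr i : (fun s => r s i) @ T --> r T i by exact: cvg_entry.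
have pos : \forall s \near T, forall i, 0 < r s i.
  apply: (@filter_forall _ _ (fun i s => 0 < r s i) (nbhs T)) => i.
  have ri : 0 < r T i by have := dp.1 i; rewrite mxE.
  exact: (cvgr_gt _ (@cr i) _ ri).
have dec : \forall s \near T, forall q : 'I_d * 'I_d, (q.1 < q.2)%N -> r s q.2 < r s q.1.
  apply: (@filter_forall _ _ (fun (q : 'I_d * 'I_d) s =>
    (q.1 < q.2)%N -> r s q.2 < r s q.1) (nbhs T)) => -[i j] /=.
  case: (ltnP i j) => ij; last by apply: nearW.
  have cij : (fun s => r s i - r s j) @ T --> r T i - r T j.
    by apply: (cvgB (F := nbhs T)); exact: cr.
  have rij : 0 < r T i - r T j by have := dp.2 i j ij; rewrite !mxE subr_gt0.
  apply: (@filterS _ (nbhs T) _ _ _ _ (cvgr_gt _ cij _ rij)) => s.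
  by rewrite subr_gt0.
have both : \forall s \near T, (forall i, 0 < r s i) /\
    forall q : 'I_d * 'I_d, (q.1 < q.2)%N -> r s q.2 < r s q.1.
  exact: (@filterI _ (nbhs T) _ _ _ pos dec).
have [e2 /= e2_gt0 near_T] := (nbhs_ballP _ _).1 both.
pose e := Num.min (e1 / 2) (e2 / 2).
have ee1 : e <= e1 / 2 by rewrite ge_min lexx.
have ee2 : e <= e2 / 2 by rewrite ge_min lexx orbT.
exists e; split; first by rewrite lt_min !divr_gt0.
move=> s /andP[Ts se].
have [|spos sdec] := near_T s; first by rewrite /ball/= ltr_norml; lra.
split; last by apply: diag; lra.
by split=> [i|i j ij]; rewrite !mxE; [exact: spos|exact: (sdec (i, j))].
Qed.

(** The set of times up to which the flow line is good is closed and open to the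
    right, so it has no supremum. *)
Lemma flow_good : good 0 -> forall t, 0 <= t -> good t.
Proof.
move=> good0 t0 t0_ge0; apply: contrapT => bad.
pose G := [set t : R | 0 <= t /\ forall s, 0 <= s <= t -> good s].
have G0 : G 0 by split=> // s /andP[s0 s0']; have -> : s = 0 by apply: le_anti; rewrite s0' s0.
have Gub t : G t -> t <= t0.
  move=> [_ Gt]; rewrite leNgt; apply/negP => t0t; apply: bad; apply: Gt.
  by rewrite t0_ge0 ltW.
have supG : has_sup G by split; [exists 0|exists t0].
pose T := sup G.
have T0 : 0 <= T by apply: sup_upper_bound.
have below s : 0 <= s < T -> good s.
  move=> /andP[s0 sT]; have [|t [_ Gt] st] := @sup_adherent _ G (T - s) _ supG.
    by rewrite subr_gt0.
  by apply: Gt; rewrite s0 ltW//; move: st; rewrite -/T; lra.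
have goodT : good T.
  case: (ltrgtP 0 T) T0 => // [T_gt0 _|<- _//]; exact: good_closed.
have [e [e0 he]] := good_open T0 goodT.
have : G (T + e).
  split=> [|s /andP[s0 sTe]]; first by rewrite addr_ge0// ltW.
  by case: (ltP s T) => sT; [apply: below; rewrite s0|apply: he; rewrite sT].
by move/(sup_upper_bound supG); rewrite -/T; lra.
Qed.

End Flow.
(** * Derivatives on the half line *)

Section HalfLine.
Variables (R : realType) (V : normedModType R).
Implicit Types (f : R -> V) (t : R) (l : V).

Lemma has_derivative_within_cvg (D : set R) f t l :
  has_derivative_within D f t l -> f s @[s --> within D t^'] --> f t.
Proof.
move=> fl.
have st : (fun s => s - t) @ within D t^' --> (0 : R).
  have st0 : (fun s => s - t) @ nbhs t --> t - t.
    by apply: (cvgB (F := nbhs t)); [exact: cvg_id|exact: cvg_cst].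
  by rewrite subrr in st0; apply: cvg_within_filter; exact: cvg_within_filter.
pose G : set_system R := within D t^'; have FG : Filter G by exact: within_filter.
have key : (fun s => f t + (s - t) *: ((s - t)^-1 *: (f s - f t))) @ G --> f t + 0 *: l.
  by apply: (cvgD (F := G)); [exact: cvg_cst|exact: (cvgZ (F := G))].
rewrite scale0r addr0 in key; apply: cvg_trans key.
apply: (@near_eq_cvg _ _ G FG).
have nt : \forall s \near G, s != t.
  exact: (@filterE _ (nbhs t) _ _ (fun s (sn : s != t) (_ : D s) => sn)).
apply: (@filterS _ G FG _ _ _ nt) => s sn.
by rewrite scalerA mulfV ?subr_eq0// scale1r addrC subrK.
Qed.

Lemma has_derivative_within_is_derive (D : set R) f t l : nbhs t D ->
  has_derivative_within D f t l -> is_derive t (1 : R) f l.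
Proof.
move=> tD fl.
have dq : (fun h : R => h^-1 *: (f (h *: 1 + t) - f t)) @ (0 : R)^' --> l.
  apply/cvgrPdist_lt => e e0.
  have fe : \forall s \near t, s != t -> D s -> `|l - (s - t)^-1 *: (f s - f t)| < e.
    by have /cvgrPdist_lt/(_ e e0) := fl; exact.
  have [e1 /= e1_gt0 he1] := (nbhs_ballP _ _).1 (filterI fe tD).
  exists e1 => //= h /= he h0.
  have [|hf hD] := he1 (h + t).
    by move: he; rewrite /ball/= sub0r opprD addrCA subrr addr0.
  have := hf _ hD; rewrite addrK [h%:A]mulr1; apply.
  by rewrite -subr_eq0 addrK.
apply: DeriveDef; first exact: cvgP dq.
exact: cvg_lim dq.
Qed.

(** Continuity on the half line becomes continuity everywhere after extension by the
    value at [0], because [max(., 0)] does not increase distances. *)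
Lemma cvg_max0 f t :
  (forall t, 0 <= t -> f s @[s --> within [set s : R | 0 <= s] t^'] --> f t) ->
  (fun s => f (Num.max s 0)) @ t --> f (Num.max t 0).
Proof.
move=> cf; set t' := Num.max t 0; have t'0 : 0 <= t' by rewrite le_max lexx orbT.
apply/cvgrPdist_lt => e e0.
have fe : \forall s \near t', s != t' -> 0 <= s -> `|f t' - f s| < e.
  by have /cvgrPdist_lt/(_ e e0) := cf _ t'0; exact.
have [e1 /= e1_gt0 he1] := (nbhs_ballP _ _).1 fe.
apply/nbhs_ballP; exists e1 => // s; rewrite /ball/= => ts.
have [->|st] := eqVneq (Num.max s 0) t'; first by rewrite subrr normr0.
apply: he1 => //; last by rewrite /= le_max lexx orbT.
apply: le_lt_trans ts; rewrite /t' !maxEle.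
have ts1 := ler_norm (t - s); have ts2 : s - t <= `|t - s| by rewrite distrC ler_norm.
by case: (leP t 0) => ?; case: (leP s 0) => ?; rewrite ler_norml; apply/andP; split; lra.
Qed.

End HalfLine.

Theorem theorem5p3 (R : realType) (n d : nat) (hd : (1 <= d)%N)
  (hn : (d <= n)%N) (A : R -> 'M[R]_(d, n + d + 1))
  (hA : forall t : R, 0 <= t ->
     has_derivative_within [set s : R | 0 <= s] A t
       (- mean_curvature (orbit_mx (A t)) (A t)))
  (P : 'M[R]_d) (Q : 'M[R]_(n + d + 1)) (r0 : 'rV[R]_d)
  (hsvd : is_svd (A 0) P r0 Q) (hr0 : distinct_positive r0) :
  exists r : R -> 'rV[R]_d,
    r 0 = r0 /\
    forall t : R, 0 <= t ->
      [/\ is_svd (A t) P (r t) Q,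
          distinct_positive (r t) &
          forall k : 'I_d,
            has_derivative_within [set s : R | 0 <= s]
              (fun s => r s 0 k : R^o) t
              (\sum_(j < d | j != k)
                 ((r t 0 k - r t 0 j)^-1 + (r t 0 k + r t 0 j)^-1)
               + (n.+1)%:R / r t 0 k)].
Proof.
case: hsvd => hP hQ _ _ A0E.
have hdm : (d <= n + d + 1)%N by rewrite addn1 ltnW// ltnS leq_addl.
have hdm1 : (d < n + d + 1)%N by rewrite addn1 ltnS leq_addl.
have mdE : (n + d + 1 - d = n.+1)%N by rewrite addnAC addnK addn1.
have hP' := orthogonal_tr hP; have hQ' := orthogonal_tr hQ.
pose h (t : R) := mean_curvature (orbit_mx (A t)) (A t).
pose B (t : R) := biact P^T Q^T (A (Num.max t 0)).
pose N (t : R) := biact P^T Q^T (- h t).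
have maxE (t : R) : 0 <= t -> Num.max t 0 = t by move=> t0; exact: max_l.
have BE (t : R) : 0 <= t -> biact P Q (B t) = A t by move=> t0; rewrite /B maxE// biactKV.
have cB (t : R) : B @ t --> B t.
  apply: (cvg_biact (F := nbhs t)); apply: cvg_max0 => s s0.
  exact: has_derivative_within_cvg (hA s s0).
have dB (t : R) : 0 < t -> is_derive t (1 : R) B (N t).
  move=> t0.
  have tD : nbhs t [set s : R | 0 <= s].
    by apply: (@filterS _ (nbhs t) _ _ _ _ (lt_nbhsr t0)) => s /ltW.
  have dA := has_derivative_within_is_derive tD (hA t (ltW t0)).
  have dA' : is_derive t (1 : R) (fun s => A (Num.max s 0)) (- h t).
    apply: near_eq_is_derive dA.
    by apply: (@filterS _ (nbhs t) _ _ _ _ tD) => s s0; rewrite maxE.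
  have dB' := is_derive_mulmx (is_derive_mulmx (is_derive_cst P^T t 1) dA')
    (is_derive_cst (Q^T)^T t 1).
  by apply: is_derive_eq dB' _; rewrite mul0mx mulmx0 add0r addr0.
have N_sym (t : R) : 0 < t ->
    (N t *m (B t)^T)^T = N t *m (B t)^T /\ ((B t)^T *m N t)^T = (B t)^T *m N t.
  move=> t0; apply: (normal_symmetric (B0 := A t)).
    by rewrite /B maxE ?ltW//; apply: orbit_biact (orbit_refl _).
  move=> X TX; rewrite /N biactN frobeniusNl frobenius_biactl !trmxK.
  rewrite mean_curvature_normal ?oppr0// // -[X in tangent_space _ X _](BE t) ?ltW//.
  exact: tangent_biact.
have N_bound r : regular r -> exists e K : R, 0 < e /\
    forall t : R, 0 < t -> frobenius (B t - rdiag _ r) (B t - rdiag _ r) < e ->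
      forall i j, `|N t i j| <= K.
  move=> hr; have [e [K [e0 hK]]] := mean_curvature_bounded hdm hr.
  exists e, K; split=> // t t0 Bt i j.
  have := hK P Q (B t) hP hQ Bt i j.
  have -> : N t i j = - biact P^T Q^T (h t) i j by rewrite /N biactN [LHS]mxE.
  by rewrite (BE t (ltW t0)) normrN.
have N_gradE (t : R) r : 0 <= t -> regular r -> B t = rdiag _ r ->
    N t = rdiag _ (log_volume_grad n.+1 r).
  move=> t0 hr Bt; rewrite /N biactN /h -BE// Bt (mean_curvature_svd hdm hP hQ hr).
  by rewrite mdE biactN opprK biactK.
have N_grad (t : R) r : 0 < t -> regular r -> B t = rdiag _ r ->
    N t = rdiag _ (log_volume_grad (n + d + 1 - d) r).
  by rewrite mdE => /ltW; exact: N_gradE.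
have B0 : B 0 = rdiag _ r0.
  rewrite /B maxE// A0E -[P *m diag_mx r0 *m _]mulmxA -/(rdiag _ _).
  exact: biactK.
have good0 : distinct_positive (rdiagonal hdm (B 0)) /\ B 0 = rdiag _ (rdiagonal hdm (B 0)).
  by rewrite B0 rdiagonalK.
have good := flow_good cB dB N_sym N_bound hdm1 N_grad good0.
exists (fun t => rdiagonal hdm (B t)); split; first by rewrite B0 rdiagonalK.
move=> t t0; have [dp Bt] := good t t0; split=> //.
  split=> // [i|i j|].
  - exact: ltW (dp.1 i).
  - by rewrite leq_eqVlt => /predU1P[/val_inj ->//|/dp.2/ltW].
  - by rewrite -[LHS]BE// {1}Bt /biact /rdiag !mulmxA.
move=> k.
have Nk := N_gradE _ _ t0 (regular_distinct_positive dp) Bt.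
pose F : set_system R := within [set s : R | 0 <= s] t^'.
have FF : Filter F by exact: within_filter.
have quot : (fun s => biact P^T Q^T ((s - t)^-1 *: (A s - A t))) @ F --> N t.
  by apply: (cvg_biact (F := F)); exact: hA.
have entry := (cvg_mxP (F := F) _ _).1 quot k (wide hdm k).
have NE : N t k (wide hdm k) = \sum_(j < d | j != k)
    ((rdiagonal hdm (B t) 0 k - rdiagonal hdm (B t) 0 j)^-1
     + (rdiagonal hdm (B t) 0 k + rdiagonal hdm (B t) 0 j)^-1)
    + n.+1%:R / rdiagonal hdm (B t) 0 k.
  by rewrite Nk (rdiagE hdm) eqxx [LHS]mxE.
rewrite -NE; pose q (s : R) : R^o := (s - t)^-1 *: (rdiagonal hdm (B s) 0 k - rdiagonal hdm (B t) 0 k).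
have nF : \forall s \near F, 0 <= s.
  exact: (@filterE _ (t^') _ _ (fun s (s0 : 0 <= s) => s0)).
have qE : \forall s \near F,
    biact P^T Q^T ((s - t)^-1 *: (A s - A t)) k (wide hdm k) = q s.
  apply: (@filterS _ F FF _ _ _ nF) => s s0.
  rewrite biactZ biactB [LHS]mxE [X in _ * X]mxE [X in _ * (_ + X)]mxE.
  by rewrite /q !mxE /B !maxE.
exact: cvg_trans (@near_eq_cvg _ _ F FF _ _ qE) (entry FF).
Qed.
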